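(* Let $(X,d_X)$ be a metric space, $p\in[1,+\infty)$ and $\mu_1,\mu_2,\nu_1,\nu_2\in\mathcal{P}_r^p(X)$. For every measure $\sigma_1\in\Pi(\mu_1,\nu_1)$ there exists a measure $\sigma_2\in\Pi(\mu_2,\nu_2)$ such that $$W_p(\sigma_1,\sigma_2)\le W_p(\mu_1,\mu_2)+W_p(\nu_1,\nu_2).$$ Hence for the Hausdorff distance $H_p$ we have $$H_p(\Pi(\mu_1,\nu_1),\Pi(\mu_2,\nu_2))\le W_p(\mu_1,\mu_2)+W_p(\nu_1,\nu_2).$$
   Context: For a metric space $(Z,d)$, $\mathcal{P}_r(Z)$ is the set of Radon probability measures on $Z$ (Borel probability measures $\mu$ such that for every Borel set $B$ and $\varepsilon>0$ there is a compact $K\subset B$ with $\mu(B\setminus K)<\varepsilon$), and $\mathcal{P}_r^p(Z)$ is the subset of measures with respect to which $z\mapsto d(z,z_0)^p$ is integrable for some (then every) $z_0\in Z$. $\Pi(\mu,\nu)$ is the set of Borel probability measures on the product with marginals $\mu$ and $\nu$. The $p$-Kantorovich metric on $\mathcal{P}_r^p(Z)$ is $$W_p(\mu,\nu)=\Bigl(\inf_{\sigma\in\Pi(\mu,\nu)}\int_{Z\times Z}d(z,z')^p\,\sigma(dz\,dz')\Bigr)^{1/p}.$$ The product $X\times X$ is equipped with the metric $d((x_1,y_1),(x_2,y_2))=d_X(x_1,x_2)+d_X(y_1,y_2)$, and $W_p(\sigma_1,\sigma_2)$ for measures on $X\times X$ is taken with respect to this metric. $H_p$ is the Hausdorff distance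 between sets of measures generated by $W_p$ on $\mathcal{P}_r^p(X\times X)$: $H_p(A,B)=\max\{\sup_{a\in A}\inf_{b\in B}W_p(a,b),\ \sup_{b\in B}\inf_{a\in A}W_p(a,b)\}$. *)

(* Defs.v *)
From HB Require Import structures.
From mathcomp Require Import all_boot all_order all_algebra.
From mathcomp Require Import all_classical all_reals all_analysis.

Set Implicit Arguments.
Unset Strict Implicit.
Unset Printing Implicit Defensive.

Import Order.TTheory GRing.Theory Num.Theory.

Local Open Scope classical_set_scope.
Local Open Scope ring_scope.

(* The library's measurable types are pointed, hence so are the metric spaces
   here. No generality is lost: a space carrying a probability measure is
   nonempty. *)
#[short(type="pmetricType")]
HB.structure Definition PointedMetric (K : numDomainType) :=
  {M of Metric K M & Pointed M}.

(* The product of metric spaces with the metric d_X + d_Y. An alias is needed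
   because the library's pseudometric on X * Y is the maximum metric. The
   topology and uniformity remain those of the library's product. *)
Definition sumprod (X Y : Type) : Type := (X * Y)%type.

Section sumprod_metric.
Context {R : realType} {X Y : pmetricType R}.

HB.instance Definition _ := Uniform.copy (sumprod X Y) (X * Y)%type.
HB.instance Definition _ := Pointed.copy (sumprod X Y) (X * Y)%type.

Definition sumprod_dist (u v : sumprod X Y) : R :=
  mdist u.1 v.1 + mdist u.2 v.2.

Definition sumprod_ball (u : sumprod X Y) (e : R) : set (sumprod X Y) :=
  [set v | sumprod_dist u v < e].

Lemma sumprod_dist_ge0 u v : 0 <= sumprod_dist u v.
Proof. by rewrite addr_ge0// mdist_ge0. Qed.

Lemma sumprod_dist_positivity u v : sumprod_dist u v = 0 -> u = v.
Proof.
case: u v => [x1 y1] [x2 y2]; rewrite /sumprod_dist /= => /eqP.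
rewrite paddr_eq0 ?mdist_ge0// => /andP[/eqP xx /eqP yy].
by rewrite (mdist_positivity _ _ xx) (mdist_positivity _ _ yy).
Qed.

Lemma sumprod_ball_center u (e : R) : 0 < e -> sumprod_ball u e u.
Proof. by move=> e0; rewrite /sumprod_ball /sumprod_dist /= !mdistxx addr0. Qed.

Lemma sumprod_ball_sym u v (e : R) : sumprod_ball u e v -> sumprod_ball v e u.
Proof.
rewrite /sumprod_ball /sumprod_dist /=.
by rewrite (metric_sym u.1) (metric_sym u.2).
Qed.

Lemma sumprod_ball_triangle u v w (e1 e2 : R) :
  sumprod_ball u e1 v -> sumprod_ball v e2 w -> sumprod_ball u (e1 + e2) w.
Proof.
rewrite /sumprod_ball /= => uv vw; apply: le_lt_trans (ltrD uv vw).
by rewrite /sumprod_dist addrACA lerD// metric_triangle.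
Qed.

Lemma sumprod_entourage :
  (entourage : set_system (sumprod X Y * sumprod X Y)) =
  entourage_ sumprod_ball.
Proof.
transitivity (entourage_ (@prod_ball R X Y)); first exact: prod_entourage.
rewrite predeqE => P; split=> -[e /= e0 eP].
- exists e => //= -[u v] /= uv; apply: eP => /=.
  rewrite /prod_ball !ballEmdist /=; split; apply: le_lt_trans uv.
  + by rewrite lerDl mdist_ge0.
  + by rewrite lerDr mdist_ge0.
- exists (e / 2) => /=; first by rewrite divr_gt0.
  move=> [u v] /= []; rewrite !ballEmdist /= => u1 u2; apply: eP => /=.
  by rewrite /sumprod_ball /sumprod_dist /= (splitr e) ltrD.
Qed.

HB.instance Definition _ := Uniform_isPseudoMetric.Build R (sumprod X Y)
  sumprod_ball_center sumprod_ball_sym sumprod_ball_triangle sumprod_entourage.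

HB.instance Definition _ := PseudoMetric_isMetric.Build R (sumprod X Y)
  sumprod_dist_ge0 sumprod_dist_positivity (fun _ _ => erefl).

End sumprod_metric.

Notation borel T := (g_sigma_algebraType (@open T)).

Section radon.
Context {R : realType} {Z : pmetricType R}.
Local Open Scope ereal_scope.

Definition radon (mu : probability (borel Z) R) : Prop :=
  forall (B : set (borel Z)) (e : R), measurable B -> (0 < e)%R ->
    exists K : set Z, [/\ compact K, K `<=` B & mu (B `\` K) < e%:E].

Definition radon_p (p : R) : set (probability (borel Z) R) :=
  [set mu | radon mu /\
     exists z0 : Z, mu.-integrable setT (fun z => (mdist z z0 `^ p)%:E)].

End radon.

(* For nonseparable spaces the Borel sigma-algebra of the product may be
   strictly larger than the product of the Borel sigma-algebras; couplings are
   measures on the former. *)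
Definition couplings {R : realType} {X Y : pmetricType R}
    (mu : probability (borel X) R) (nu : probability (borel Y) R) :
    set (probability (borel (sumprod X Y)) R) :=
  [set sigma |
     (forall A : set (borel X), measurable A ->
        pushforward sigma (fst : borel (sumprod X Y) -> borel X) A = mu A) /\
     (forall B : set (borel Y), measurable B ->
        pushforward sigma (snd : borel (sumprod X Y) -> borel Y) B = nu B)].

Section kantorovich.
Context {R : realType}.
Local Open Scope ereal_scope.

Definition kantorovich {Z : pmetricType R} (p : R)
    (mu nu : probability (borel Z) R) : \bar R :=
  poweR (ereal_inf [set \int[sigma]_z (mdist z.1 z.2 `^ p)%:E
                   | sigma in couplings mu nu])
        p^-1.

Definition kantorovich_hausdorff {Z : pmetricType R} (p : R)
    (A B : set (probability (borel Z) R)) : \bar R :=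
  maxe (ereal_sup [set ereal_inf [set kantorovich p a b | b in B] | a in A])
       (ereal_sup [set ereal_inf [set kantorovich p a b | a in A] | b in B]).

End kantorovich.

(* Main.v *)
(** Gluing near-optimal plans of (mu1, mu2) and (nu1, nu2) to [sigma1] exactly
    would require disintegrations. Gluing them up to a countable partition of
    small mesh is elementary: two probabilities under which the cells have the
    same law are coupled by a countable sum of product measures, one for each
    cell. This gives laws of (x1, y1, x2, y2) with (x1, y1) ~ [sigma1],
    x2 ~ [mu2], y2 ~ [nu2] and, by Minkowski's inequality, cost at most
    W_p(mu1, mu2) + W_p(nu1, nu2) + O(1/n).

    Let n tend to infinity along an ultrafilter, pointwise on boxes
    A1 x A2 x A3 x A4 of Borel sets. The four marginals being fixed and Radon,
    boxes are approximated by compact boxes from inside and by open boxes from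
    outside uniformly in n, so the limit is countably subadditive on boxes and
    extends to a measure. The cost is an increasing limit of simple functions
    over boxes, hence passes to the limit. *)

Require Import Defs.
From HB Require Import structures.
From mathcomp Require Import finmap.
From mathcomp Require Import all_boot all_order all_algebra.
From mathcomp Require Import all_classical all_reals all_analysis.
From mathcomp Require Import measurable_realfun.
From mathcomp Require Import lra.

Set Implicit Arguments.
Unset Strict Implicit.
Unset Printing Implicit Defensive.

Import Order.TTheory GRing.Theory Num.Theory.
Import numFieldNormedType.Exports.

Local Open Scope classical_set_scope.
Local Open Scope ring_scope.

(** Gluing and the passage to the limit take place on product sigma-algebras, whereas couplings are
    measures on the Borel sets of [sumprod X X], of which there may be more when [X] is not
    separable. To cross this gap, note that the four marginals, being Radon, are carried by a common
    sigma-compact set [S]. The map [r] that fixes [S] and is constant off it has separable range, so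
    [r] x [r] is measurable from the product sigma-algebra to the Borel sets of the product, and it
    moves points only on null sets. Cells and costs are therefore written through [r], and the final
    measures are images under [r] taken in each coordinate.

    An ultrafilter is used instead of a subsequence because the boxes may be uncountably many, so
    that no diagonal extraction reaches all of them; along an ultrafilter all their masses converge
    at once. *)

(** * Image laws and the semiring of rectangles *)

Lemma measurable_preimage d1 d2 (T1 : measurableType d1)
    (T2 : measurableType d2) (f : T1 -> T2) (A : set T2) :
  measurable_fun setT f -> measurable A -> measurable (f @^-1` A).
Proof. by move=> mf mA; rewrite -[X in measurable X]setTI; exact: mf. Qed.

Lemma probability_ex d (T : measurableType d) (R : realType)
    (M : {measure set T -> \bar R}) : M setT = 1%E ->
  exists P : probability T R, (P : set T -> \bar R) = M.
Proof.
move=> M1; pose N := mscale (NngNum (@ler01 R)) M.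
have NM : N = M by apply/funext => A; rewrite /N /mscale/= mul1e.
have N1 : N setT = 1%E by rewrite NM.
pose PN := Measure_isProbability.Build _ _ _ N N1.
exists (HB.pack_for (probability T R) N PN (Measure.on N)).
by rewrite -NM.
Qed.

Lemma law_ex d1 d2 (T1 : measurableType d1) (T2 : measurableType d2)
    (R : realType) (P : probability T1 R) (f : T1 -> T2) :
  measurable_fun setT f ->
  exists Q : probability T2 R, (Q : set T2 -> \bar R) = pushforward P f.
Proof.
move=> mf.
pose mf' := isMeasurableFun.Build _ _ _ _ _ mf.
pose F : {mfun T1 >-> T2} := HB.pack f mf'.
by exists (distribution P F).
Qed.

Lemma integral_law d1 d2 (T1 : measurableType d1) (T2 : measurableType d2)
    (R : realType) (P : probability T1 R) (Q : probability T2 R) (f : T1 -> T2)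
    (g : T2 -> \bar R) :
  measurable_fun setT f -> (forall A, measurable A -> Q A = P (f @^-1` A)) ->
  measurable_fun setT g -> (forall y, (0 <= g y)%E) ->
  (\int[Q]_y g y = \int[P]_x g (f x))%E.
Proof.
move=> mf QPf mg g0; have [Q' Q'E] := law_ex P mf.
transitivity (\int[Q']_y g y)%E; last by rewrite Q'E ge0_integral_pushforward.
apply: eq_measure_integral => A mA _.
by rewrite [LHS]QPf//; exact: esym (congr1 (@^~ A) Q'E).
Qed.

(* [T1 * T2] itself carries the product sigma-algebra, hence the alias. *)
Definition rect (T1 T2 : Type) : Type := (T1 * T2)%type.

Fact rect_display : measure_display -> measure_display -> measure_display.
Proof. by []. Qed.

Section rect_semiring.
Context d1 d2 (T1 : semiRingOfSetsType d1) (T2 : semiRingOfSetsType d2).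

HB.instance Definition _ := Pointed.copy (rect T1 T2) (T1 * T2)%type.

Definition rect_measurable : set (set (rect T1 T2)) :=
  [set A `*` B | A in measurable & B in measurable].

Let rect0 : rect_measurable set0.
Proof. by exists set0 => //; exists set0 => //; rewrite set0X. Qed.

Let rectI : setI_closed rect_measurable.
Proof.
move=> _ _ [A1 mA1 [B1 mB1 <-]] [A2 mA2 [B2 mB2 <-]].
exists (A1 `&` A2); first exact: measurableI.
by exists (B1 `&` B2); [exact: measurableI|rewrite setXI].
Qed.

Let rectD : semi_setD_closed rect_measurable.
Proof.
move=> _ _ [A1 mA1 [B1 mB1 <-]] [A2 mA2 [B2 mB2 <-]].
have [D [finD Dm AD tD]] := semi_measurableD _ _ mA1 mA2.
have [E [finE Em BE tE]] := semi_measurableD _ _ mB1 mB2.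
(* The difference is the disjoint union of (A1 \ A2) x B1 and (A1 ∩ A2) x (B1 \ B2), each cut along
   the finite decomposition of its difference factor. *)
exists ([set X `*` B1 | X in D] `|` [set (A1 `&` A2) `*` Y | Y in E]); split.
- by rewrite finite_setU; split; exact: finite_image.
- move=> _ [[X DX <-]|[Y EY <-]].
  + by exists X; [exact: Dm|exists B1].
  + by exists (A1 `&` A2); [exact: measurableI|exists Y => //; exact: Em].
- apply/seteqP; split=> [[x y] /= [[A1x B1y]]|[x y]].
  + rewrite not_andP => nAB.
    have [A2x|nA2x] := pselect (A2 x).
      have : (B1 `\` B2) y by split => //; case: nAB.
      rewrite BE => -[Y EY Yy]; exists ((A1 `&` A2) `*` Y) => //.
      by right; exists Y.
    have : (A1 `\` A2) x by [].
    by rewrite AD => -[X DX Xx]; exists (X `*` B1) => //; left; exists X.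
  + case=> _ [[X DX <-]|[Y EY <-]] /= [].
    * move=> Xx B1y; have : (A1 `\` A2) x by rewrite AD; exists X.
      by case=> A1x nA2x; split => // -[].
    * move=> [A1x A2x] Yy; have : (B1 `\` B2) y by rewrite BE; exists Y.
      by case=> B1y nB2y; split => // -[].
- move=> _ _ [[X DX <-]|[Y EY <-]] [[X' DX' <-]|[Y' EY' <-]] [[x y] [/=]].
  + by move=> [Xx _] [X'x _]; congr (_ `*` _); apply: tD => //; exists x.
  + move=> [Xx _] [[_ A2x] _]; have : (A1 `\` A2) x by rewrite AD; exists X.
    by case.
  + move=> [[_ A2x] _] [Xx _]; have : (A1 `\` A2) x by rewrite AD; exists X'.
    by case.
  + by move=> [_ Yy] [_ Y'y]; congr (_ `*` _); apply: tE => //; exists y.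
Qed.

HB.instance Definition _ := isSemiRingOfSets.Build (rect_display d1 d2)
  (rect T1 T2) rect0 rectI rectD.

End rect_semiring.

(** * Ultralimits of contents *)

Section ultralimit.
Context (R : realType) (U : set_system nat).
Hypothesis UU : UltraFilter U.

(** By compactness of [0, 1] the image ultrafilter has a cluster point, and an ultrafilter converges
    to each of its cluster points. *)
Lemma ultra_cvg01 (u : nat -> R) : (forall n, 0 <= u n <= 1) ->
  exists2 l : R, 0 <= l <= 1 & u @ U --> l.
Proof.
move=> u01; have := @segment_compact R 0 1.
move=> /(_ (u @ U) _)[|l [/= l01 lu]].
  apply: (@filterS _ U _ setT); last exact: filterT.
  by move=> n _ /=; rewrite in_itv/= u01.
exists l; first by rewrite in_itv in l01.
move=> V nV; have [//|UnV] := in_ultra_setVsetC (u @^-1` V) UU.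
by have [x [/= nVx Vx]] := lu (~` V) _ UnV nV.
Qed.

Context d (T : semiRingOfSetsType d).
Variables (L : nat -> {content set T -> \bar R}).
Hypothesis L1 : forall n A, measurable A -> (L n A <= 1)%E.
(* Meant for the compact and the open members of the semiring; kept abstract
   since the semiring and the topology live on different aliases of a type. *)
Variables compact_class open_class : set (set T).
Hypothesis class_cover : forall K (O : nat -> set T), compact_class K ->
  (forall i, open_class (O i)) -> K `<=` \bigcup_i O i ->
  exists D : {fset nat}, K `<=` \bigcup_(i in [set` D]) O i.
Hypothesis inner : forall A (e : R), measurable A -> 0 < e ->
  exists K, [/\ compact_class K, measurable K, K `<=` A &
    forall n, (L n A <= L n K + e%:E)%E].
Hypothesis outer : forall A (e : R), measurable A -> 0 < e ->
  exists O, [/\ open_class O, measurable O, A `<=` O &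
    forall n, (L n O <= L n A + e%:E)%E].

Let Lfin n A : measurable A -> L n A \is a fin_num.
Proof.
move=> mA; rewrite ge0_fin_numE ?measure_ge0//.
by rewrite (le_lt_trans (L1 n mA))// ltry.
Qed.

Lemma ultralimit_measure :
  exists M : {measure set (g_sigma_algebraType (@measurable _ T)) -> \bar R},
  forall A : set T, measurable A ->
    M A \is a fin_num /\ (fun n => fine (L n A)) @ U --> fine (M A).
Proof.
(* Truncation at 1 keeps the sequence in [0, 1] for every set, so that choice yields a total
   function [l]; on the semiring nothing is cut off. *)
pose u A n : R := Num.min 1 (fine (L n A)).
have uE A n : measurable A -> u A n = fine (L n A).
  move=> mA; apply/min_idPr; rewrite -lee_fin fineK ?Lfin//; exact: L1.
have u01 A n : 0 <= u A n <= 1.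
  by rewrite /u le_min ler01 fine_ge0 ?measure_ge0//= ge_min lexx.
have [l l0 l01] : exists2 l : set T -> R,
    (forall A, 0 <= l A) & (forall A, u A @ U --> l A).
  have /choice[l lu] : forall A, exists l : R, 0 <= l /\ u A @ U --> l.
    by move=> A; have [l /andP[? _] ?] := ultra_cvg01 (u01 A); exists l.
  by exists l => A; have [] := lu A.
have lcvg A : measurable A -> (fun n => fine (L n A)) @ U --> l A.
  move=> mA; rewrite -(_ : u A = fun n => fine (L n A))//.
  by apply/funext => n; rewrite uE.
have lle A B (e : R) : measurable A -> measurable B ->
    (forall n, (L n A <= L n B + e%:E)%E) -> l A <= l B + e.
  move=> mA mB LAB.
  have lBe : (fun n => fine (L n B) + e) @ U --> l B + e.
    by apply: cvgD; [exact: lcvg|exact: cvg_cst].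
  apply: (@ler_cvg_to nat U _ R _ _ _ _ (lcvg _ mA) lBe).
  apply: nearW => n.
  by rewrite -lee_fin EFinD !fineK ?Lfin.
pose mu (A : set T) : \bar R := (l A)%:E.
have mu_ge0 A : (0 <= mu A)%E by rewrite lee_fin.
have mu_add : measure_function.semi_additive mu.
  move=> F n mF tF mUF; rewrite /mu sumEFin; congr EFin.
  rewrite -(cvg_lim (@Rhausdorff R) (lcvg _ mUF)).
  apply: (cvg_lim (@Rhausdorff R)).
  have -> : (fun k => fine (L k (\big[setU/set0]_(i < n) F i))) =
      (fun k => \sum_(i < n) fine (L k (F i))).
    apply/funext => k; rewrite measure_semi_additive// sum_fine//.
    by move=> i _; exact: Lfin.
  by apply: cvg_big => [|i _]; [exact: add_continuous|exact: lcvg].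
pose muC := isContent.Build _ T R mu mu_ge0 mu_add.
pose muc : {content set T -> \bar R} := HB.pack mu muC.
have mu_sub : measurable_subset_sigma_subadditive mu.
  move=> A F mF mA AF.
  (* Half of [e] pays for shrinking [A] to [K]. The other half, split into shares e / 2 / 2^(i+1),
     pays for enlarging each [F i] to [G i]. A finite subcover then reduces the claim to finite
     subadditivity of a content. *)
  apply/lee_addgt0Pr => _/posnumP[e].
  rewrite [e%:num]splitr [in leRHS]EFinD addeA -leeBlDr//.
  apply: le_trans (epsilon_trick _ _ _) => //=.
  have [K [cK mK KA LK]] := inner mA [gt0 of e%:num / 2].
  have /choice[G /all_and4[oO mO FO LO]] : forall i, exists Oi,
      [/\ open_class Oi, measurable Oi, F i `<=` Oi &
       forall n, (L n Oi <= L n (F i) + (e%:num / 2 / (2 ^ i.+1)%:R)%:E)%E].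
    by move=> i; apply: outer => //; rewrite divr_gt0// ltr0n expn_gt0.
  have [|D KD] := class_cover cK oO.
    apply: (subset_trans KA); apply: (subset_trans AF).
    by apply: subset_bigcup => i _; exact: FO.
  have muK : (mu K <= \sum_(i <- D) mu (G i))%E.
    rewrite -[D]set_fsetK -fsbig_finite//.
    exact: (@content_sub_fsum _ _ _ muc).
  rewrite (@le_trans _ _ (mu K))//.
    by rewrite lee_fin lerBlDr; exact: lle.
  rewrite (le_trans muK)//.
  rewrite nneseries_esum//; last first.
    by move=> k _; rewrite adde_ge0// lee_fin divr_ge0.
  rewrite esum_ge//; exists [set` D] => //; rewrite fsbig_finite//= set_fsetK.
  apply: lee_sum => k _.
  by rewrite -EFinD lee_fin; exact: lle.
pose muM := Content_SigmaSubAdditive_isMeasure.Build _ R T muc mu_sub.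
pose mum : {measure set T -> \bar R} := HB.pack mu muC muM.
exists (measure_extension mum) => A mA.
have -> /= : (measure_extension mum : {measure set _ -> \bar R}) A = mu A.
  exact: measurable_mu_extE.
by split => //=; exact: lcvg.
Qed.

End ultralimit.

(** * Gluing along a countable partition *)

Lemma measurable_neq_nat d1 d2 (T1 : measurableType d1) (T2 : measurableType d2)
    (q1 : T1 -> nat) (q2 : T2 -> nat) :
  (forall i, measurable (q1 @^-1` [set i])) ->
  (forall i, measurable (q2 @^-1` [set i])) ->
  measurable [set z : T1 * T2 | q1 z.1 != q2 z.2].
Proof.
move=> mq1 mq2; rewrite (_ : mkset _ = \bigcup_i
    ((q1 @^-1` [set i]) `*` ~` (q2 @^-1` [set i]))).
  apply: bigcup_measurable => i _; apply: measurableX => //.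
  exact: measurableC.
apply/seteqP; split => [[x y] /= /eqP xy|[x y] [i _ [/= <-] /eqP]].
  by exists (q1 x) => //; split => //= /esym.
by rewrite eq_sym.
Qed.

Section glue.
Context d1 d2 (T1 : measurableType d1) (T2 : measurableType d2) (R : realType).
Variables (P1 : probability T1 R) (P2 : probability T2 R).
Variables (q1 : T1 -> nat) (q2 : T2 -> nat).
Hypothesis mq1 : forall i, measurable (q1 @^-1` [set i]).
Hypothesis mq2 : forall i, measurable (q2 @^-1` [set i]).
Hypothesis q12 : forall i, P1 (q1 @^-1` [set i]) = P2 (q2 @^-1` [set i]).
Local Open Scope ereal_scope.

Let C i := (q1 @^-1` [set i]) `*` (q2 @^-1` [set i]).

Let mC i : measurable (C i). Proof. exact: measurableX. Qed.

Let p i := fine (P1 (q1 @^-1` [set i])).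

Let pE i : P1 (q1 @^-1` [set i]) = (p i)%:E.
Proof. by rewrite fineK// fin_num_measure. Qed.

Let p_ge0 i : (0 <= (p i)^-1)%R.
Proof. by rewrite invr_ge0 fine_ge0. Qed.

(* On a null cell the junk value [0^-1 = 0] is harmless. *)
Let glue_measure : {measure set (T1 * T2) -> \bar R} :=
  mseries (fun i => mscale (NngNum (p_ge0 i)) (mrestr (P1 \x P2) (mC i))) 0.

Let glue_measureE A B : measurable A -> measurable B ->
  glue_measure (A `*` B) = \sum_(i <oo) ((p i)^-1)%:E *
    (P1 (A `&` q1 @^-1` [set i]) * P2 (B `&` q2 @^-1` [set i])).
Proof.
move=> mA mB; apply: eq_eseriesr => i _.
transitivity (((p i)^-1)%:E * (P1 \x P2) ((A `*` B) `&` C i)); first by [].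
rewrite /C -setXI product_measure1E//.
- exact: measurableI.
- exact: measurableI.
Qed.

Let sum_cells d (T : measurableType d) (P : probability T R) (q : T -> nat) A :
  (forall i, measurable (q @^-1` [set i])) -> measurable A ->
  \sum_(i <oo) P (A `&` q @^-1` [set i]) = P A.
Proof.
move=> mq mA; rewrite -[in RHS](setIT A).
have -> : [set: T] = \bigcup_i (q @^-1` [set i]).
  by apply/seteqP; split => // x _; exists (q x).
rewrite setI_bigcupr measure_semi_bigcup//.
- by move=> i; exact: measurableI.
- move=> i j _ _ [x [[_ /= qi] [_ /= qj]]]; by rewrite -qi -qj.
- by apply: bigcup_measurable => i _; exact: measurableI.
Qed.

(** In the first marginal of [A], cell [i] contributes P1 (A ∩ cell) times P2 (cell) / p i, and
    [q12] makes the last quotient 1; the second marginal is symmetric. Every summand lives on some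
    [C i], where both labels equal [i]. *)
Lemma glue : exists Q : probability (T1 * T2)%type R,
  [/\ forall A, measurable A -> Q (fst @^-1` A) = P1 A,
      forall B, measurable B -> Q (snd @^-1` B) = P2 B &
      Q [set z | q1 z.1 != q2 z.2] = 0].
Proof.
have Q1 A : measurable A -> glue_measure (fst @^-1` A) = P1 A.
  move=> mA; rewrite (_ : fst @^-1` A = A `*` setT); last first.
    by apply/seteqP; split => [[x y]|[x y] []].
  rewrite glue_measureE// -(sum_cells P1 mq1 mA).
  apply: eq_eseriesr => i _; rewrite setTI -q12 pE.
  (* On a null cell the summand is 0 by the junk inverse, and so is the mass of [A] in that cell. *)
  have [p0|p0] := eqVneq (p i) 0%R.
    rewrite p0 invr0 mul0e; apply/esym/eqP; rewrite -measure_le0.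
    have -> : 0 = (p i)%:E :> \bar R by rewrite p0.
    rewrite -pE; apply: le_measure; rewrite ?inE//.
    exact: measurableI.
  by rewrite muleCA -EFinM mulVf// mule1.
have Q2 B : measurable B -> glue_measure (snd @^-1` B) = P2 B.
  move=> mB; rewrite (_ : snd @^-1` B = setT `*` B); last first.
    by apply/seteqP; split => [[x y]|[x y] []].
  rewrite glue_measureE// -(sum_cells P2 mq2 mB).
  apply: eq_eseriesr => i _; rewrite setTI pE.
  have [p0|p0] := eqVneq (p i) 0%R.
    rewrite p0 invr0 mul0e; apply/esym/eqP; rewrite -measure_le0.
    have -> : 0 = (p i)%:E :> \bar R by rewrite p0.
    rewrite -pE q12; apply: le_measure; rewrite ?inE//.
    exact: measurableI.
  by rewrite muleA -EFinM mulVf// mul1e.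
have QT : glue_measure setT = 1.
  by rewrite -[setT]/(fst @^-1` setT) Q1 ?probability_setT.
have [Q QE] := probability_ex QT.
exists Q; rewrite QE; split => //.
rewrite [LHS]eseries0// => i _ _.
transitivity (((p i)^-1)%:E *
  (P1 \x P2) ([set z | q1 z.1 != q2 z.2] `&` C i)); first by [].
rewrite (_ : _ `&` _ = set0) ?measure0 ?mule0//.
by rewrite -subset0 => -[x y] [/= nq [/= e1 e2]]; move: nq; rewrite e1 e2 eqxx.
Qed.

End glue.

(** * Borel sets and Radon measures on metric spaces *)

Lemma measure_setI_full d (T : measurableType d) (R : realType)
    (P : {measure set T -> \bar R}) (S A : set T) :
  measurable S -> P (~` S) = 0%E -> measurable A -> P A = P (A `&` S).
Proof.
move=> mS PS mA; rewrite [LHS](@measureDI _ _ _ P A S)// -[RHS]add0e.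
congr (_ + _)%E; apply/eqP; rewrite -measure_le0 -PS.
apply: le_measure; rewrite ?inE; [exact: measurableD|exact: measurableC|].
by move=> x [].
Qed.

Lemma measure_preimage_id d (T : measurableType d) (R : realType)
    (P : {measure set T -> \bar R}) (S A : set T) (f : T -> T) :
  measurable S -> P (~` S) = 0%E -> measurable_fun setT f ->
  (forall x, S x -> f x = x) -> measurable A -> P (f @^-1` A) = P A.
Proof.
move=> mS PS mf fS mA.
have mfA : measurable (f @^-1` A) by exact: measurable_preimage.
rewrite (measure_setI_full mS)// [RHS](measure_setI_full mS)//; congr (P _).
by apply/seteqP; split => x /= [+ Sx]; rewrite fS.
Qed.

Section borel_metric.
Context (R : realType).
Implicit Types X Y : pmetricType R.

Lemma open_mdistP X (A : set X) :
  open A <-> forall x, A x ->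
    exists2 e : R, 0 < e & forall y, mdist x y < e -> A y.
Proof.
rewrite openE; split=> [AA x Ax|AA x Ax].
  have /nbhs_ballP[e /= e0 xeA] := AA _ Ax.
  by exists e => // y xy; apply: xeA; rewrite ballEmdist.
have [e e0 xeA] := AA _ Ax.
by apply/nbhs_ballP; exists e => //= y; rewrite ballEmdist; exact: xeA.
Qed.

Lemma open_mdist_lt X (a : X) (e : R) : open [set x | mdist x a < e].
Proof.
apply/open_mdistP => x /= xe; exists (e - mdist x a); first by rewrite subr_gt0.
move=> y; rewrite ltrBrDr => h; apply: le_lt_trans h.
by rewrite (le_trans (metric_triangle y x a))// (metric_sym y x) addrC.
Qed.

Lemma borel_open X (A : set X) : open A -> measurable (A : set (borel X)).
Proof. exact: sub_sigma_algebra. Qed.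

Lemma borel_closed X (A : set X) : closed A -> measurable (A : set (borel X)).
Proof.
move=> cA; rewrite -[A]setCK; apply: measurableC; apply: borel_open.
by rewrite openC.
Qed.

Lemma borel_compact X (A : set X) : compact A -> measurable (A : set (borel X)).
Proof. by move=> /(compact_closed (@metric_hausdorff R X))/borel_closed. Qed.

Lemma compact_finite_net X (K : set X) (e : R) : 0 < e -> compact K ->
  exists s : seq X, forall x, K x -> exists2 y, y \in s & mdist x y < e.
Proof.
move=> e0; rewrite compact_cover => /(_ X K (fun a => [set x | mdist x a < e])).
case=> [a _|x Kx|D _ KD]; first exact: open_mdist_lt.
  by exists x => //=; rewrite mdistxx.
by exists D => x /KD[a]; exists a.
Qed.

(* Values in a separable set make a pair of Borel maps Borel for the Borel
   sigma-algebra of the product, see [measurable_sumprod]. *)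
Definition separable_range T X (f : T -> X) :=
  exists a : nat -> X, forall t (e : R), 0 < e ->
    exists k, mdist (f t) (a k) < e.

Lemma separable_range_comp T' T X (f : T -> X) (g : T' -> T) :
  separable_range f -> separable_range (f \o g).
Proof. by case=> a fa; exists a => t e e0; exact: fa. Qed.

Lemma separable_range_pair T X Y (f : T -> X) (g : T -> Y) :
  separable_range f -> separable_range g ->
  separable_range (fun t => (f t, g t) : sumprod X Y).
Proof.
move=> [a fa] [b gb].
exists (fun k => if unpickle k is Some (i, j) then (a i, b j) else point).
move=> t e e0; have e20 : 0 < e / 2 by rewrite divr_gt0.
have [i fi] := fa t _ e20; have [j gj] := gb t _ e20.
exists (pickle (i, j)); rewrite pickleK.
by rewrite [ltRHS]splitr; exact: ltrD.
Qed.

Lemma measurable_mdist_lt d (T : measurableType d) X (f : T -> borel X) (a : X)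
    (e : R) :
  measurable_fun setT f -> measurable [set t | mdist (f t : X) a < e].
Proof.
move=> mf; rewrite -[X in measurable X]setTI.
apply: (mf measurableT [set x : X | mdist x a < e]).
by apply: borel_open; exact: open_mdist_lt.
Qed.

(** An open [V] need not be a countable union of open boxes. However, the boxes of radius 1/(n+1)
    around the points [(a i, b j)] that lie inside [V] are countably many and cover every value of
    the pair in [V], which is enough for the preimage. *)
Lemma measurable_sumprod d (T : measurableType d) X Y
    (f : T -> borel X) (g : T -> borel Y) :
  measurable_fun setT f -> measurable_fun setT g ->
  separable_range (f : T -> X) -> separable_range (g : T -> Y) ->
  measurable_fun setT (fun t => (f t, g t) : borel (sumprod X Y)).
Proof.
move=> mf mg [a fa] [b gb].
refine (@measurability _ _ T (borel (sumprod X Y)) setT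
  (fun t => (f t, g t) : borel (sumprod X Y)) (@open (sumprod X Y)) _ _) => //.
move=> _ [V /open_mdistP oV <-]; rewrite setTI.
pose P (i : nat * nat * nat) := forall x y, mdist x (a i.1.1) < i.2.+1%:R^-1 ->
  mdist y (b i.1.2) < i.2.+1%:R^-1 -> V (x, y).
rewrite (_ : _ @^-1` V = \bigcup_i [set t | [/\ P i,
    mdist (f t : X) (a i.1.1) < i.2.+1%:R^-1 &
    mdist (g t : Y) (b i.1.2) < i.2.+1%:R^-1]]); last first.
  apply/seteqP; split => [t /= Vt|t [i _ [Pi fi gi]]]; last exact: Pi.
  have [e e0 tV] := oV _ Vt.
  (* Each of the two coordinates is reached through a centre, at the price of two radii; four radii
     must fit into [e]. *)
  have [n en] : exists n : nat, n.+1%:R^-1 < e / 4.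
    have [n] := @ltr_add_invr R 0 (e / 4) ltac:(by rewrite divr_gt0).
    by rewrite add0r; exists n.
  have n0 : 0 < n.+1%:R^-1 :> R by rewrite invr_gt0 ltr0n.
  have [i fi] := fa t _ n0; have [j gj] := gb t _ n0.
  exists (i, j, n) => //; split => // x y /= xa yb; apply: tV.
  suff : mdist (f t : X) x + mdist (g t : Y) y < e by [].
  have := metric_triangle (f t : X) (a i) x.
  have := metric_triangle (g t : Y) (b j) y.
  rewrite (metric_sym (a i)) (metric_sym (b j)); move: fi gj xa yb en.
  move: (mdist (f t : X) x) (mdist (g t : Y) y) (mdist (f t : X) (a i))
    (mdist (g t : Y) (b j)) (mdist x (a i)) (mdist y (b j)) (n.+1%:R^-1).
  by move=> ? ? ? ? ? ? ?; lra.
apply: countable_bigcupT_measurable => // i.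
have [Pi|nPi] := pselect (P i).
  rewrite (_ : mkset _ = [set t | mdist (f t : X) (a i.1.1) < i.2.+1%:R^-1] `&`
    [set t | mdist (g t : Y) (b i.1.2) < i.2.+1%:R^-1]).
    by apply: measurableI; exact: measurable_mdist_lt.
  by apply/seteqP; split => [t []|t [? ?]].
rewrite (_ : mkset _ = set0)//.
by rewrite -subset0 => t [].
Qed.

(** Compact sets exhausting each [m i] up to 1/(n+1) have a union [S] of full measure for all of
    them, and finite nets of these compact sets make [S] separable. Off [S] the value of [r] is
    [point], which need not belong to [S]; one extra point does not harm separability. *)
Lemma radon_separable_retraction X (m : nat -> probability (borel X) R) :
  (forall i, radon (m i)) ->
  exists (S : set (borel X)) (r : borel X -> borel X),
    [/\ measurable S, forall i, m i (~` S) = 0%E, measurable_fun setT r,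
    separable_range (r : X -> X) & forall x, S x -> r x = x].
Proof.
move=> mr.
have /choice[K Km] : forall i : nat * nat, exists K : set X, compact K /\
    (m i.1 (~` K) < (i.2.+1%:R^-1)%:E)%E.
  move=> i; have i0 : 0 < i.2.+1%:R^-1 :> R by rewrite invr_gt0 ltr0n.
  have [K [cK _ mK]] := mr i.1 setT _ measurableT i0.
  by exists K; rewrite -setTD.
pose S := \bigcup_i K i.
have mS : measurable (S : set (borel X)).
  apply: countable_bigcupT_measurable => // i.
  by apply: borel_compact; have [] := Km i.
have mSC i : m i (~` S) = 0%E.
  apply/eqP; rewrite -measure_le0; apply/lee_addgt0Pr => e e0.
  rewrite add0e; have [n] := @ltr_add_invr R 0 e e0.
  rewrite add0r => en; rewrite (@le_trans _ _ (m i (~` K (i, n))))//.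
    apply: le_measure; rewrite ?inE.
    - exact: measurableC.
    - by apply: measurableC; apply: borel_compact; have [] := Km (i, n).
    - by apply: subsetC => x Kx; exists (i, n).
  by have [_ /ltW h] := Km (i, n); rewrite (le_trans h)// lee_fin ltW.
exists S, (fun x => if x \in S then x else point); split => //.
- move=> _ A mA; rewrite setTI.
  rewrite (_ : _ @^-1` A = (A `&` S) `|` (~` S `&` [set x | A point])).
    apply: measurableU; first exact: measurableI.
    apply: measurableI; first exact: measurableC.
    have [Ap|nAp] := pselect (A point).
      by rewrite (_ : mkset _ = setT)//; apply/seteqP; split.
    by rewrite (_ : mkset _ = set0)//; apply/seteqP; split.
  apply/seteqP; split => x /=.
    case: ifPn => [|]; first by rewrite inE; left.
    by rewrite notin_setE; right.
  case: ifPn => [|]; rewrite ?inE ?notin_setE.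
    by move=> Sx [[]|[]].
  by move=> nSx [[]|[]].
- have /choice[s sK] : forall i : nat * nat * nat, exists s : seq X,
      forall x, K i.1 x -> exists2 y, y \in s & mdist x y < i.2.+1%:R^-1.
    move=> i; apply: compact_finite_net; last by have [] := Km i.1.
    by rewrite invr_gt0 ltr0n.
  exists (fun k => if unpickle k is Some (i, j) then nth point (s i) j
                   else point).
  move=> x e e0; case: ifPn => [|_]; last first.
    (* An index just past the end of a net makes [nth] return its default [point], which is the
       value of [r] off [S]. *)
    exists (pickle ((0, 0, 0), size (s (0, 0, 0)))%N).
    by rewrite pickleK nth_default// mdistxx.
  rewrite inE => -[i _ Kx].
  have [n] := @ltr_add_invr R 0 e e0; rewrite add0r => en.
  have [y ys xy] := sK (i, n) x Kx.
  exists (pickle ((i, n), index y (s (i, n)))).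
  by rewrite pickleK nth_index// (lt_trans xy).
- by move=> x Sx; rewrite mem_set.
Qed.

End borel_metric.

(** * Limits of measures on boxes *)

Lemma openX (S T : topologicalType) (A : set S) (B : set T) :
  open A -> open B -> open (A `*` B).
Proof.
move=> oA oB; rewrite openE => -[x y] [/= Ax By]; exists (A, B) => //=.
by split; apply: open_nbhs_nbhs; split.
Qed.

Section box_limit.
Context (R : realType) (X : pmetricType R).
Local Notation bX := (borel X).
Local Notation bX4 := ((bX * bX) * (bX * bX))%type.
Local Notation boxes := (rect (rect bX bX) (rect bX bX)).
Local Open Scope ereal_scope.

Lemma measurable_box (A : set boxes) : measurable A -> measurable (A : set bX4).
Proof.
move=> [_ [A1 mA1 [A2 mA2 <-]] [_ [A3 mA3 [A4 mA4 <-]] <-]].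
by apply: measurableX; exact: measurableX.
Qed.

Lemma box_content (P : probability bX4 R) :
  exists c : {content set boxes -> \bar R}, (c : set boxes -> \bar R) = P.
Proof.
have P_add :
    @measure_function.semi_additive _ _ boxes (P : set boxes -> \bar R).
  move=> F n mF tF mUF; apply: (@measure_semi_additive _ _ _ P) => //.
  - by move=> k; exact: measurable_box.
  - exact: measurable_box.
pose Pc := isContent.Build _ boxes R (P : set boxes -> \bar R)
  (fun A => measure_ge0 P A) P_add.
by exists (HB.pack_for {content set boxes -> \bar R}
  (P : set boxes -> \bar R) Pc).
Qed.

(** Preimages of Borel sets under the coordinates are boxes, so the sigma-algebra generated by the
    boxes contains the product one. A measure extended from the boxes can thus be read on the
    product. *)
Lemma box_sigma_id : measurable_fun setT
  (id : g_sigma_algebraType (@measurable _ boxes) -> bX4).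
Proof.
have mT : @measurable _ bX setT := measurableT.
apply/measurable_fun_pairP; split; apply/measurable_fun_pairP; split;
  move=> _ A mA; rewrite setTI; apply: sub_sigma_algebra.
- exists (A `*` setT); first by exists A => //; exists setT.
  exists (setT `*` setT); first by exists setT => //; exists setT.
  by apply/seteqP; split => [[[? ?] [? ?]] [[]]|[[? ?] [? ?]]].
- exists (setT `*` A); first by exists setT => //; exists A.
  exists (setT `*` setT); first by exists setT => //; exists setT.
  by apply/seteqP; split => [[[? ?] [? ?]] [[]]|[[? ?] [? ?]]].
- exists (setT `*` setT); first by exists setT => //; exists setT.
  exists (A `*` setT); first by exists A => //; exists setT.
  by apply/seteqP; split => [[[? ?] [? ?]] [[? ?] []]|[[? ?] [? ?]]].
- exists (setT `*` setT); first by exists setT => //; exists setT.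
  exists (setT `*` A); first by exists setT => //; exists A.
  by apply/seteqP; split => [[[? ?] [? ?]] [[? ?] []]|[[? ?] [? ?]]].
Qed.

Lemma radon_inner (m : probability bX R) (A : set X) (e : R) : radon m ->
  measurable (A : set bX) -> (0 < e)%R ->
  exists K : set X, [/\ compact K, measurable (K : set bX), K `<=` A &
    m (A `\` K) <= e%:E].
Proof.
move=> mR mA e0; have [K [cK KA mK]] := mR _ _ mA e0.
by exists K; split => //; [exact: borel_compact|exact: ltW].
Qed.

(** A compact set approximating the complement of [A] from inside has an open complement, compact
    sets being closed in a metric space. *)
Lemma radon_outer (m : probability bX R) (A : set X) (e : R) : radon m ->
  measurable (A : set bX) -> (0 < e)%R ->
  exists V : set X, [/\ open V, measurable (V : set bX), A `<=` V &
    m (V `\` A) <= e%:E].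
Proof.
move=> mR mA e0; have mCA : measurable (~` A : set bX) by exact: measurableC.
have [K [cK KA mK]] := mR _ _ mCA e0.
exists (~` K); split.
- by rewrite openC; exact: (compact_closed (@metric_hausdorff R X)).
- by apply: measurableC; exact: borel_compact.
- exact: subsetCr.
- by rewrite setDE setIC -setDE; exact: ltW.
Qed.

Variables m1 m2 m3 m4 : probability bX R.

Definition box_marginals (P : probability bX4 R) :=
  [/\ forall A : set bX, measurable A -> P [set z | A z.1.1] = m1 A,
      forall A : set bX, measurable A -> P [set z | A z.1.2] = m2 A,
      forall A : set bX, measurable A -> P [set z | A z.2.1] = m3 A &
      forall A : set bX, measurable A -> P [set z | A z.2.2] = m4 A].

(** A point of the first box outside the second has some coordinate in Ai \ Bi. The four exceptional
    events are measured by the marginals alone, so the bound is the same for all [P] with these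
    marginals. It serves for inner and outer approximation alike. *)
Lemma box_approx (P : probability bX4 R) (A1 A2 A3 A4 B1 B2 B3 B4 : set bX)
    (e : R) : box_marginals P ->
  measurable A1 -> measurable A2 -> measurable A3 -> measurable A4 ->
  measurable B1 -> measurable B2 -> measurable B3 -> measurable B4 ->
  m1 (A1 `\` B1) <= (e / 4)%:E -> m2 (A2 `\` B2) <= (e / 4)%:E ->
  m3 (A3 `\` B3) <= (e / 4)%:E -> m4 (A4 `\` B4) <= (e / 4)%:E ->
  P ((A1 `*` A2) `*` (A3 `*` A4)) <= P ((B1 `*` B2) `*` (B3 `*` B4)) + e%:E.
Proof.
move=> [P1 P2 P3 P4] mA1 mA2 mA3 mA4 mB1 mB2 mB3 mB4 AB1 AB2 AB3 AB4.
have mf11 : measurable_fun setT (fun z : bX4 => z.1.1).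
  exact: measurableT_comp.
have mf12 : measurable_fun setT (fun z : bX4 => z.1.2).
  exact: measurableT_comp.
have mf21 : measurable_fun setT (fun z : bX4 => z.2.1).
  exact: measurableT_comp.
have mf22 : measurable_fun setT (fun z : bX4 => z.2.2).
  exact: measurableT_comp.
have mpre (f : bX4 -> bX) A B : measurable_fun setT f -> measurable A ->
    measurable B -> measurable [set z | (A `\` B) (f z)].
  move=> mf mA mB; apply: (measurable_preimage (A := A `\` B) mf).
  exact: measurableD.
pose B := (B1 `*` B2) `*` (B3 `*` B4).
pose N1 : set bX4 := [set z | (A1 `\` B1) z.1.1].
pose N2 : set bX4 := [set z | (A2 `\` B2) z.1.2].
pose N3 : set bX4 := [set z | (A3 `\` B3) z.2.1].
pose N4 : set bX4 := [set z | (A4 `\` B4) z.2.2].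
have mN1 : measurable N1 by exact: (mpre (fun z => z.1.1)).
have mN2 : measurable N2 by exact: (mpre (fun z => z.1.2)).
have mN3 : measurable N3 by exact: (mpre (fun z => z.2.1)).
have mN4 : measurable N4 by exact: (mpre (fun z => z.2.2)).
have PN1 : P N1 <= (e / 4)%:E.
  by rewrite [P N1](P1 (A1 `\` B1))//; exact: measurableD.
have PN2 : P N2 <= (e / 4)%:E.
  by rewrite [P N2](P2 (A2 `\` B2))//; exact: measurableD.
have PN3 : P N3 <= (e / 4)%:E.
  by rewrite [P N3](P3 (A3 `\` B3))//; exact: measurableD.
have PN4 : P N4 <= (e / 4)%:E.
  by rewrite [P N4](P4 (A4 `\` B4))//; exact: measurableD.
have mB : measurable B by apply: measurableX; exact: measurableX.
apply: (@le_trans _ _ (P (B `|` (N1 `|` (N2 `|` (N3 `|` N4)))))).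
  apply: le_measure; rewrite ?inE.
  - by apply: measurableX; exact: measurableX.
  - by do 4 apply: measurableU => //.
  - move=> [[x1 x2] [x3 x4]] [[/= ? ?] [/= ? ?]].
    have [b1|?] := pselect (B1 x1); last by right; left.
    have [b2|?] := pselect (B2 x2); last by right; right; left.
    have [b3|?] := pselect (B3 x3); last by right; right; right; left.
    have [b4|?] := pselect (B4 x4); last by right; right; right; right.
    by left.
have -> : e%:E =
    (e / 4)%:E + ((e / 4)%:E + ((e / 4)%:E + (e / 4)%:E)) :> \bar R.
  by rewrite -!EFinD; congr EFin; lra.
rewrite (le_trans (measureU2 _ _ _))//; first by do 3 apply: measurableU => //.
apply: leeD => //; rewrite (le_trans (measureU2 _ _ _))//.
  by do 2 apply: measurableU => //.
apply: leeD; first exact: PN1.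
rewrite (le_trans (measureU2 _ _ _))//; first by apply: measurableU => //.
apply: leeD; first exact: PN2.
rewrite (le_trans (measureU2 _ _ _))//.
apply: leeD; first exact: PN3.
exact: PN4.
Qed.

Lemma box_limit (U : set_system nat) (L : nat -> probability bX4 R) :
  UltraFilter U -> radon m1 -> radon m2 -> radon m3 -> radon m4 ->
  (forall n, box_marginals (L n)) ->
  exists M : probability bX4 R, forall A1 A2 A3 A4 : set bX,
    measurable A1 -> measurable A2 -> measurable A3 -> measurable A4 ->
    (fun n => fine (L n ((A1 `*` A2) `*` (A3 `*` A4)))) @ U -->
      fine (M ((A1 `*` A2) `*` (A3 `*` A4))).
Proof.
move=> UU r1 r2 r3 r4 LM.
have /choice[c cL] := fun n => box_content (L n).
pose cpt : set (set boxes) :=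
  fun A => compact (A : set ((X * X) * (X * X))%type).
pose opn : set (set boxes) :=
  fun A => open (A : set ((X * X) * (X * X))%type).
have [||||M ML] := @ultralimit_measure R U UU _ boxes c _ cpt opn.
- by move=> n A /measurable_box mA; rewrite cL; exact: probability_le1.
- move=> K G cK oG KG.
  (* The topology of [sumprod] is by definition that of the product, so compactness carries over
     unchanged. *)
  have {}cK : compact (K : set (sumprod (sumprod X X) (sumprod X X))).
    exact: cK.
  rewrite compact_cover in cK.
  have [//|D _ KD] := cK nat setT G (fun i _ => oG i).
  by exists D.
- move=> _ e [_ [A1 mA1 [A2 mA2 <-]] [_ [A3 mA3 [A4 mA4 <-]] <-]] e0.
  have e4 : (0 < e / 4)%R by rewrite divr_gt0.
  have [K1 [cK1 mK1 KA1 AK1]] := radon_inner r1 mA1 e4.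
  have [K2 [cK2 mK2 KA2 AK2]] := radon_inner r2 mA2 e4.
  have [K3 [cK3 mK3 KA3 AK3]] := radon_inner r3 mA3 e4.
  have [K4 [cK4 mK4 KA4 AK4]] := radon_inner r4 mA4 e4.
  exists ((K1 `*` K2) `*` (K3 `*` K4)); split.
  + by apply: compact_setX; exact: compact_setX.
  + by exists (K1 `*` K2);[exists K1 => //; exists K2|
      exists (K3 `*` K4) => //; exists K3 => //; exists K4].
  + by apply: setSX; apply: setSX.
  + by move=> n; rewrite !cL; exact: box_approx.
- move=> _ e [_ [A1 mA1 [A2 mA2 <-]] [_ [A3 mA3 [A4 mA4 <-]] <-]] e0.
  have e4 : (0 < e / 4)%R by rewrite divr_gt0.
  have [K1 [cK1 mK1 KA1 AK1]] := radon_outer r1 mA1 e4.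
  have [K2 [cK2 mK2 KA2 AK2]] := radon_outer r2 mA2 e4.
  have [K3 [cK3 mK3 KA3 AK3]] := radon_outer r3 mA3 e4.
  have [K4 [cK4 mK4 KA4 AK4]] := radon_outer r4 mA4 e4.
  exists ((K1 `*` K2) `*` (K3 `*` K4)); split.
  + by apply: openX; exact: openX.
  + by exists (K1 `*` K2);[exists K1 => //; exists K2|
      exists (K3 `*` K4) => //; exists K3 => //; exists K4].
  + by apply: setSX; apply: setSX.
  + by move=> n; rewrite !cL; exact: box_approx.
have mT : @measurable _ bX setT := measurableT.
have box A1 A2 A3 A4 : @measurable _ bX A1 -> @measurable _ bX A2 ->
  @measurable _ bX A3 -> @measurable _ bX A4 ->
  @measurable _ boxes ((A1 `*` A2) `*` (A3 `*` A4)).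
  move=> ? ? ? ?; exists (A1 `*` A2); first by exists A1 => //; exists A2.
  by exists (A3 `*` A4) => //; exists A3 => //; exists A4.
have MT : M setT = 1.
  have [fM cM] := ML _ (box _ _ _ _ mT mT mT mT).
  have -> : M setT = M ((setT `*` setT) `*` (setT `*` setT)) by rewrite !setXTT.
  rewrite -(fineK fM); congr EFin; rewrite -(cvg_lim (@Rhausdorff R) cM).
  apply: (cvg_lim (@Rhausdorff R)).
  rewrite (_ : (fun n => _) = fun=> 1%R); first exact: cvg_cst.
  by apply/funext => n; rewrite cL !setXTT probability_setT.
have [Q QM] := probability_ex MT.
have [N NQ] := law_ex Q box_sigma_id.
exists N => A1 A2 A3 A4 mA1 mA2 mA3 mA4.
have [_] := ML _ (box _ _ _ _ mA1 mA2 mA3 mA4).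
rewrite NQ QM /pushforward preimage_id.
rewrite (_ : (fun n => _) =
  (fun n => fine (L n ((A1 `*` A2) `*` (A3 `*` A4)))))//.
by apply/funext => n; rewrite cL.
Qed.

End box_limit.

(** * Lower semicontinuity of the cost *)

(** If x^p - e is positive, its p-th root [c] lies below [x], and monotonicity of the power gives
    the bound beyond [c]; otherwise the bound is trivial. This is the source of the lower
    semicontinuity of the cost. *)
Lemma powR_lower_continuous (R : realType) (p x e : R) :
  0 < p -> 0 <= x -> 0 < e ->
  exists2 d, 0 < d & forall y, 0 <= y -> x - d < y -> x `^ p - e <= y `^ p.
Proof.
move=> p0 x0 e0; have [xpe|xpe] := leP (x `^ p - e) 0.
  by exists 1 => // y _ _; rewrite (le_trans xpe)// powR_ge0.
pose c := (x `^ p - e) `^ p^-1.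
have cp : c `^ p = x `^ p - e.
  by rewrite /c -powRrM mulVf ?gt_eqF// powRr1// ltW.
have cx : c < x.
  rewrite ltNge; apply/negP => xc.
  have := ge0_ler_powR (ltW p0) x0 (powR_ge0 _ _) xc.
  by rewrite cp lerBrDr gerDl leNgt e0.
exists (x - c); first by rewrite subr_gt0.
move=> y y0; rewrite opprB addrC subrK => cy.
rewrite -cp; apply: ge0_ler_powR => //; first exact: ltW.
  exact: powR_ge0.
exact: ltW.
Qed.

(** Inverting the power at x^p + e provides [d]. It will absorb the errors of order 1/n added to the
    distances before the power is taken. *)
Lemma powR_upper_continuous (R : realType) (p x e : R) :
  0 < p -> 0 <= x -> 0 < e ->
  exists2 d, 0 < d & (x + d) `^ p <= x `^ p + e.
Proof.
move=> p0 x0 e0; pose c := (x `^ p + e) `^ p^-1.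
have xpe0 : 0 <= x `^ p + e by rewrite addr_ge0 ?powR_ge0// ltW.
have cp : c `^ p = x `^ p + e by rewrite /c -powRrM mulVf ?gt_eqF// powRr1.
have xc : x < c.
  rewrite ltNge; apply/negP => cx.
  have := ge0_ler_powR (ltW p0) (powR_ge0 _ _) x0 cx.
  by rewrite cp gerDl leNgt e0.
exists (c - x); first by rewrite subr_gt0.
by rewrite addrC subrK cp.
Qed.

Section integral_lower_semicontinuity.
Context (R : realType) (X : pmetricType R).
Local Notation bX := (borel X).
Local Notation bX4 := ((bX * bX) * (bX * bX))%type.
Local Open Scope ereal_scope.
Variables (r : bX -> bX) (a : nat -> X).
Hypothesis mr : measurable_fun setT r.
Hypothesis ra : forall x (e : R), (0 < e)%R ->
  exists k, (mdist (r x : X) (a k) < e)%R.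
Variable f : bX4 -> R.
Hypothesis f_ge0 : forall z, (0 <= f z)%R.
Hypothesis f_lsc : forall z (e : R), (0 < e)%R ->
  exists2 d, (0 < d)%R & forall z',
  (mdist (r z.1.1 : X) (r z'.1.1) < d)%R ->
  (mdist (r z.1.2 : X) (r z'.1.2) < d)%R ->
  (mdist (r z.2.1 : X) (r z'.2.1) < d)%R ->
  (mdist (r z.2.2 : X) (r z'.2.2) < d)%R ->
  (f z - e <= f z')%R.

(* The bits of [x] tell which of the first [m] balls of each of the first [m]
   radii contain [r x]; these partitions are finite and refine one another. *)
Let cell m (x : bX) : {set 'I_m * 'I_m} :=
  [set i : 'I_m * 'I_m | (mdist (r x : X) (a i.1) < i.2.+1%:R^-1)%R]%SET.

Let index m : finType := ({set 'I_m * 'I_m} * {set 'I_m * 'I_m} *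
  ({set 'I_m * 'I_m} * {set 'I_m * 'I_m}))%type.

Let cells m (z : bX4) : index m :=
  ((cell m z.1.1, cell m z.1.2), (cell m z.2.1, cell m z.2.2)).

Let measurable_cell m t : measurable (cell m @^-1` [set t]).
Proof.
rewrite (_ : _ @^-1` _ = \bigcap_(i in [set: 'I_m * 'I_m])
   [set x | (mdist (r x : X) (a i.1) < i.2.+1%:R^-1)%R = (i \in t)]).
  apply: fin_bigcap_measurable; first exact: finite_finset.
  move=> i _; have [it|it] := boolP (i \in t).
    exact: measurable_mdist_lt.
  rewrite (_ : mkset _ =
      ~` [set x | (mdist (r x : X) (a i.1) < i.2.+1%:R^-1)%R]).
    by apply: measurableC; exact: measurable_mdist_lt.
  by apply/seteqP; split => x /= => [->|/negP/negbTE].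
apply/seteqP; split => x /= => [<- i _|xt]; first by rewrite inE.
by apply/setP => i; rewrite inE; exact: xt.
Qed.

Let cellsE m t : cells m @^-1` [set t] =
  ((cell m @^-1` [set t.1.1]) `*` (cell m @^-1` [set t.1.2])) `*`
  ((cell m @^-1` [set t.2.1]) `*` (cell m @^-1` [set t.2.2])).
Proof.
apply/seteqP; split => [z /= <-//|z].
by case: t => [[t1 t2] [t3 t4]] [[/= <- <-] [/= <- <-]].
Qed.

Let measurable_cells m t : measurable (cells m @^-1` [set t]).
Proof.
rewrite cellsE; apply: measurableX; apply: measurableX;
  exact: measurable_cell.
Qed.

(** Composed with [cells m], this is the largest function below [f] that is constant on the cells of
    level [m]. An empty cell gets the default value 0 of [inf], harmless since the cell has no
    mass. *)
Let phi m (t : index m) : R := inf [set f z | z in cells m @^-1` [set t]].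

Let g m z := phi (cells m z).

Let g_ge0 m z : (0 <= g m z)%R.
Proof.
apply: lb_le_inf; first by exists (f z); exists z.
by move=> _ [z' _ <-].
Qed.

Let g_le m z : (g m z <= f z)%R.
Proof.
apply: ge_inf; last by exists z.
by exists 0%R => _ [z' _ <-].
Qed.

Let phi_ge0 m t : (0 <= phi (m := m) t)%R.
Proof.
rewrite /phi; set A := (X in inf X).
have [->|/set0P A0] := eqVneq A set0; first by rewrite inf0.
by apply: lb_le_inf => // _ [z' _ <-].
Qed.

Let cells_homo m n z z' : (m <= n)%N -> cells n z = cells n z' ->
  cells m z = cells m z'.
Proof.
move=> mn.
suff H x x' : cell n x = cell n x' -> cell m x = cell m x'.
  by case=> /H h1 /H h2 /H h3 /H h4; rewrite /cells h1 h2 h3 h4.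
move=> xx'; apply/setP => i; rewrite !inE.
have /setP/(_ (widen_ord mn i.1, widen_ord mn i.2)) := xx'.
by rewrite !inE.
Qed.

Let g_homo z : {homo g ^~ z : m n / (m <= n)%N >-> (m <= n)%R}.
Proof.
move=> m n mn; apply: lb_le_inf; first by exists (f z); exists z.
move=> _ [z' zz' <-]; rewrite /g -(cells_homo mn zz'); exact: g_le.
Qed.

(** Once the cell of [z] records, for each coordinate, a ball of radius below d / 2 containing its
    image under [r], any point of the same cell is [d]-close to [z] in each coordinate, and [f_lsc]
    bounds the infimum from below. *)
Let g_cvg z : g ^~ z @ \oo --> f z.
Proof.
apply/cvgrPdist_le => e e0.
have [d d0 fd] := f_lsc z e0.
have [j jd] : exists j : nat, (j.+1%:R^-1 < d / 2)%R.
  have [|j] := @ltr_add_invr R 0 (d / 2); first by rewrite divr_gt0.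
  by rewrite add0r; exists j.
have j0 : (0 < j.+1%:R^-1 :> R)%R by rewrite invr_gt0 ltr0n.
have [k1 zk1] := ra z.1.1 j0.
have [k2 zk2] := ra z.1.2 j0.
have [k3 zk3] := ra z.2.1 j0.
have [k4 zk4] := ra z.2.2 j0.
have close m x x' k : (mdist (r x : X) (a k) < j.+1%:R^-1)%R -> (k < m)%N ->
    (j < m)%N -> cell m x' = cell m x -> (mdist (r x : X) (r x') < d)%R.
  move=> xk km jm /setP/(_ (Ordinal km, Ordinal jm)); rewrite !inE/= xk => x'k.
  rewrite (le_lt_trans (metric_triangle _ (a k) _))// [ltRHS]splitr ltrD//.
    exact: lt_trans jd.
  by rewrite metric_sym; exact: lt_trans jd.
(* The indices of [cell m] range over 'I_m, so [m] must strictly exceed the radius index [j] and the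
   four centre indices. *)
exists (maxn j (maxn (maxn k1 k2) (maxn k3 k4))).+1 => // m /=.
rewrite !gtn_max => /andP[jm /andP[/andP[k1m k2m] /andP[k3m k4m]]].
rewrite ger0_norm ?subr_ge0 ?g_le// lerBlDr -lerBlDl.
apply: lb_le_inf; first by exists (f z); exists z.
move=> _ [z' [z11 z12 z21 z22] <-]; apply: fd.
- exact: close zk1 k1m jm z11.
- exact: close zk2 k2m jm z12.
- exact: close zk3 k3m jm z21.
- exact: close zk4 k4m jm z22.
Qed.

Let integral_g m (P : {measure set bX4 -> \bar R}) :
  \int[P]_z (g m z)%:E = \sum_t (phi t)%:E * P (cells m @^-1` [set t]).
Proof.
transitivity (\int[P]_z \sum_t (phi t)%:E * (\1_(cells m @^-1` [set t]) z)%:E).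
  apply: eq_integral => z _; rewrite (bigD1 (cells m z))//= big1 ?adde0.
    by rewrite indicE mem_set// mule1.
  move=> t tz; rewrite indicE memNset ?mule0//= => zt.
  by rewrite zt eqxx in tz.
rewrite ge0_integral_sum//=.
- apply: eq_bigr => t _; rewrite ge0_integralZl_EFin//=.
  + by rewrite (integral_indic _ _ (measurable_cells t)) ?setIT.
  + by apply/measurable_EFinP; apply: measurable_indic; exact: measurable_cells.
- move=> t; apply: emeasurable_funM => //.
  by apply/measurable_EFinP; apply: measurable_indic; exact: measurable_cells.
- by move=> t z _; rewrite mule_ge0// lee_fin.
Qed.

(** As in Fatou's lemma, the exchange of limits is one-sided. For fixed [m] the integral of [g m] is
    a finite combination of box masses, so its limit in [n] is exact and inherits the bound from
    [f]; only then does [m] grow, under [M] alone. *)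
Lemma integral_box_limit_le (U : set_system nat) (L : nat -> probability bX4 R)
    (M : probability bX4 R) (C : R) :
  UltraFilter U ->
  (forall A1 A2 A3 A4 : set bX,
    measurable A1 -> measurable A2 -> measurable A3 -> measurable A4 ->
    (fun n => fine (L n ((A1 `*` A2) `*` (A3 `*` A4)))) @ U -->
      fine (M ((A1 `*` A2) `*` (A3 `*` A4)))) ->
  measurable_fun setT f ->
  (forall e : R, (0 < e)%R ->
    \forall n \near U, \int[L n]_z (f z)%:E <= (C + e)%:E) ->
  \int[M]_z (f z)%:E <= C%:E.
Proof.
move=> UU LM mf LC.
have cvg_g m : (fun n => fine (\int[L n]_z (g m z)%:E)) @ U -->
    fine (\int[M]_z (g m z)%:E).
  have fineE (P : probability bX4 R) : fine (\int[P]_z (g m z)%:E) =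
      (\sum_t phi t * fine (P (cells m @^-1` [set t])))%R.
    rewrite integral_g -sum_fine; last first.
      by move=> t _; rewrite fin_numM// fin_num_measure.
    by apply: eq_bigr => t _; rewrite fineM// fin_num_measure.
  rewrite fineE (_ : (fun n => _) =
    (fun n => \sum_t phi t * fine (L n (cells m @^-1` [set t])))%R); last first.
    by apply/funext => n; rewrite fineE.
  apply: cvg_big => [|t _]; first exact: add_continuous.
  apply: cvgM; first exact: cvg_cst.
  by rewrite cellsE; apply: LM; exact: measurable_cell.
have gfin m (P : probability bX4 R) : \int[P]_z (g m z)%:E \is a fin_num.
  rewrite integral_g; apply/sum_fin_numP => t _ _.
  by rewrite fin_numM// fin_num_measure.
have mg m : measurable_fun setT (fun z => (g m z)%:E).
  apply/measurable_EFinP => _ B mB; rewrite setTI.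
  rewrite (_ : _ @^-1` B =
      \bigcup_(t in [set t | B (phi t)]) (cells m @^-1` [set t])).
    by apply: fin_bigcup_measurable => // t _; exact: measurable_cells.
  apply/seteqP; split => [z Bz|z [t Bt /= zt]]; first by exists (cells m z).
  by rewrite /g zt.
have gC m : \int[M]_z (g m z)%:E <= C%:E.
  rewrite -(fineK (gfin m M)) lee_fin; apply/ler_addgt0Pr => e e0.
  apply: (@ler_cvg_to nat U _ R _ _ _ _ (cvg_g m) (cvg_cst (C + e)%R)).
  apply: filterS (LC e e0) => n LnC.
  rewrite -lee_fin fineK//; apply: le_trans LnC.
  apply: ge0_le_integral => //.
  - by move=> z _; rewrite lee_fin.
  - by apply/measurable_EFinP.
  - by move=> z _; rewrite lee_fin g_le.
have g0 m z : setT z -> 0 <= (g m z)%:E by rewrite lee_fin.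
have gnd z : setT z ->
    {homo (fun m => (g m z)%:E) : m n / (m <= n)%N >-> m <= n}.
  by move=> _ m n mn; rewrite lee_fin g_homo.
have := @cvg_monotone_convergence _ _ _ M setT measurableT
  (fun m z => (g m z)%:E) mg g0 gnd.
rewrite (_ : (fun z => limn (fun m => (g m z)%:E)) = (fun z => (f z)%:E));
    last first.
  apply/funext => z; apply: cvg_lim => //.
  by apply: cvg_EFin; [exact: nearW|exact: g_cvg].
move=> cvgf; rewrite -(cvg_lim (@ereal_hausdorff R) cvgf).
apply: lime_le; first by apply/cvg_ex; eexists; exact: cvgf.
by apply: nearW => m; exact: gC.
Qed.

End integral_lower_semicontinuity.

(** * The Kantorovich distance *)

Section kantorovich_basics.
Context (R : realType).
Implicit Types X Y Z : pmetricType R.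
Local Open Scope ereal_scope.

Lemma measurable_fst_sumprod X Y :
  measurable_fun setT (fst : borel (sumprod X Y) -> borel X).
Proof.
refine (@measurability _ _ (borel (sumprod X Y)) (borel X) setT fst
  (@open X) _ _) => //.
move=> _ [V /open_mdistP oV <-]; rewrite setTI; apply: borel_open.
apply/open_mdistP => z /oV[e e0 zV]; exists e => // z' zz'; apply: zV.
by apply: le_lt_trans zz'; rewrite lerDl mdist_ge0.
Qed.

Lemma measurable_snd_sumprod X Y :
  measurable_fun setT (snd : borel (sumprod X Y) -> borel Y).
Proof.
refine (@measurability _ _ (borel (sumprod X Y)) (borel Y) setT snd
  (@open Y) _ _) => //.
move=> _ [V /open_mdistP oV <-]; rewrite setTI; apply: borel_open.
apply/open_mdistP => z /oV[e e0 zV]; exists e => // z' zz'; apply: zV.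
by apply: le_lt_trans zz'; rewrite lerDr mdist_ge0.
Qed.

(** The distance is 1-Lipschitz for the sum metric, hence its strict sublevel sets are open. *)
Lemma measurable_mdist Z :
  measurable_fun setT (fun z : borel (sumprod Z Z) => mdist (z.1 : Z) z.2 : R).
Proof.
refine (@measurability _ _ _ _ setT _ _ (@RGenInftyO.measurableE R) _).
move=> _ [_ [x ->] <-]; rewrite setTI.
apply: (@borel_open R (sumprod Z Z)); apply/open_mdistP => z /=.
rewrite in_itv/= => zx; exists (x - mdist z.1 z.2)%R; first by rewrite subr_gt0.
move=> z'; rewrite ltrBrDr => zz'.
rewrite in_itv/= (le_lt_trans _ zz')//.
rewrite [leRHS](_ : _ = (mdist z.1 z'.1 + mdist z.2 z'.2 + mdist z.1 z.2)%R)//.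
have := metric_triangle z'.1 z.1 z'.2; have := metric_triangle z.1 z.2 z'.2.
rewrite (metric_sym z'.1 z.1).
move: (mdist z'.1 z'.2) (mdist z.1 z'.1) (mdist z.2 z'.2) (mdist z.1 z.2)
  (mdist z.1 z'.2).
by move=> ? ? ? ? ?; lra.
Qed.

Lemma measurable_mdist_powR Z (p : R) :
  measurable_fun setT
    (fun z : borel (sumprod Z Z) => (mdist (z.1 : Z) z.2 `^ p)%:E).
Proof.
apply/measurable_EFinP; apply: measurableT_comp (measurable_powR p) _.
exact: measurable_mdist.
Qed.

Lemma measurable_swap_sumprod Z :
  measurable_fun setT
    (fun z : borel (sumprod Z Z) => (z.2, z.1) : borel (sumprod Z Z)).
Proof.
refine (@measurability _ _ _ (borel (sumprod Z Z)) setT _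
  (@open (sumprod Z Z)) _ _) => //.
move=> _ [V /open_mdistP oV <-]; rewrite setTI; apply: borel_open.
apply/open_mdistP => z /oV[e e0 zV]; exists e => // z' zz'; apply: zV.
by apply: le_lt_trans zz'; rewrite [leLHS]addrC.
Qed.

Lemma kantorovich_ge0 Z (p : R) (mu nu : probability (borel Z) R) :
  0 <= kantorovich p mu nu.
Proof. exact: poweR_ge0. Qed.

Lemma kantorovich_le Z (p : R) (mu nu : probability (borel Z) R) sigma :
  (0 < p)%R -> couplings mu nu sigma ->
  kantorovich p mu nu <= (\int[sigma]_z (mdist (z.1 : Z) z.2 `^ p)%:E) `^ p^-1.
Proof.
move=> p0 mn; apply: gt0_ler_poweR; first by rewrite invr_ge0 ltW.
- rewrite in_itv/= leey andbT.
  apply: le_ereal_inf_tmp => _ [s _ <-]; apply: integral_ge0 => z _.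
  by rewrite lee_fin powR_ge0.
- rewrite in_itv/= leey andbT; apply: integral_ge0 => z _.
  by rewrite lee_fin powR_ge0.
- by apply: ereal_inf_lbound; exists sigma.
Qed.

Lemma kantorovich_sym Z (p : R) (mu nu : probability (borel Z) R) :
  kantorovich p mu nu = kantorovich p nu mu.
Proof.
congr (ereal_inf _ `^ _).
suff H m1 m2 : [set \int[sigma]_z (mdist (z.1 : Z) z.2 `^ p)%:E
    | sigma in couplings m1 m2] `<=`
  [set \int[sigma]_z (mdist (z.1 : Z) z.2 `^ p)%:E | sigma in couplings m2 m1].
  by apply/seteqP; split; exact: H.
move=> _ [s [s1 s2] <-]; have [t ts] := law_ex s (@measurable_swap_sumprod Z).
exists t; first by split=> A mA; rewrite /pushforward ts; [exact: s2|exact: s1].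
have tE A : measurable A ->
    t A = s ((fun z => (z.2, z.1) : borel (sumprod Z Z)) @^-1` A).
  by rewrite ts.
rewrite (integral_law (@measurable_swap_sumprod Z) tE
  (@measurable_mdist_powR Z p)).
  by apply: eq_integral => z _ /=; rewrite metric_sym.
by move=> z; rewrite lee_fin powR_ge0.
Qed.

(** The infimum is w^p, strictly below (w + e)^p. The error is added under the power so that
    Minkowski's inequality can use the bound directly. *)
Lemma kantorovich_near_optimal Z (p w e : R) (mu nu : probability (borel Z) R) :
  (0 < p)%R -> kantorovich p mu nu = w%:E -> (0 < e)%R ->
  exists2 s, couplings mu nu s &
    \int[s]_z (mdist (z.1 : Z) z.2 `^ p)%:E <= ((w + e) `^ p)%:E.
Proof.
rewrite /kantorovich => p0; set I := ereal_inf _ => Iw e0.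
have I0 : 0 <= I.
  apply: le_ereal_inf_tmp => _ [s _ <-]; apply: integral_ge0 => z _.
  by rewrite lee_fin powR_ge0.
have w0 : (0 <= w)%R by rewrite -lee_fin -Iw poweR_ge0.
have IE : I = (w `^ p)%:E.
  by rewrite -poweR_EFin -Iw -poweRrM mulVf ?gt_eqF// poweRe1.
have [|_ [s ms <-] sw] := @ereal_inf_lt R _ ((w + e) `^ p)%:E (_ : I < _).
  rewrite IE lte_fin gt0_ltr_powR// ?nnegrE ?addr_ge0// ?ltrDl//.
  exact: ltW.
by exists s => //; exact: ltW.
Qed.

End kantorovich_basics.

(** * Minkowski's inequality and partitions of small mesh *)

Section Lp_estimates.
Context d (T : measurableType d) (R : realType) (P : probability T R).
Variable p : R.
Hypothesis p1 : 1 <= p.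
Local Open Scope ereal_scope.

Let p0 : (0 < p)%R. Proof. exact: lt_le_trans p1. Qed.

Lemma Lnorm_le_integral (h : T -> R) (c : R) :
  (forall x, 0 <= h x)%R -> (0 <= c)%R ->
  \int[P]_x (h x `^ p)%:E <= (c `^ p)%:E ->
  Lnorm P p%:E (EFin \o h) <= c%:E.
Proof.
move=> h0 c0 hc; rewrite unlock.
have -> : c%:E = (c `^ p)%:E `^ p^-1.
  by rewrite poweR_EFin -powRrM mulfV ?gt_eqF// powRr1.
apply: gt0_ler_poweR; first by rewrite invr_ge0 ltW.
- rewrite in_itv/= leey andbT; apply: integral_ge0 => x _.
  by rewrite lee_fin powR_ge0.
- by rewrite in_itv/= leey andbT lee_fin powR_ge0.
- apply: le_trans hc; rewrite le_eqVlt; apply/orP; left; apply/eqP.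
  by apply: eq_integral => x _ /=; rewrite ger0_norm.
Qed.

Lemma integral_le_Lnorm (h : T -> R) (c : R) :
  (forall x, 0 <= h x)%R -> (0 <= c)%R ->
  Lnorm P p%:E (EFin \o h) <= c%:E ->
  \int[P]_x (h x `^ p)%:E <= (c `^ p)%:E.
Proof.
move=> h0 c0 hc; rewrite -poweR_EFin.
have -> : \int[P]_x (h x `^ p)%:E = Lnorm P p%:E (EFin \o h) `^ p.
  rewrite poweR_Lnorm; last by rewrite gt_eqF.
  by apply: eq_integral => x _ /=; rewrite ger0_norm.
apply: gt0_ler_poweR; first exact: ltW.
- by rewrite in_itv/= leey andbT Lnorm_ge0.
- by rewrite in_itv/= leey andbT lee_fin.
- exact: hc.
Qed.

(** Minkowski's inequality is applied twice; a constant has itself as norm, [P] being a probability.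
    The pointwise bound is asked almost everywhere because glued points share a cell only almost
    surely. *)
Lemma Lp_triangle (H G1 G2 : T -> R) (A B c : R) :
  measurable_fun setT H -> measurable_fun setT G1 -> measurable_fun setT G2 ->
  (forall x, 0 <= H x)%R ->
  (forall x, 0 <= G1 x)%R -> (forall x, 0 <= G2 x)%R ->
  (0 <= A)%R -> (0 <= B)%R -> (0 <= c)%R ->
  {ae P, forall x, (H x <= G1 x + G2 x + c)%R} ->
  \int[P]_x (G1 x `^ p)%:E <= (A `^ p)%:E ->
  \int[P]_x (G2 x `^ p)%:E <= (B `^ p)%:E ->
  \int[P]_x (H x `^ p)%:E <= ((A + B + c) `^ p)%:E.
Proof.
move=> mH mG1 mG2 H0 G10 G20 A0 B0 c0 HG G1A G2B.
have mp (h : T -> R) : measurable_fun setT h ->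
    measurable_fun setT (fun x => (h x `^ p)%:E).
  move=> mh; apply/measurable_EFinP.
  exact: measurableT_comp (measurable_powR p) mh.
pose G : T -> R := ((G1 \+ G2) \+ cst c)%R.
have G0 x : (0 <= G x)%R by rewrite /G/= !addr_ge0.
have mG12 : measurable_fun setT (G1 \+ G2)%R by exact: measurable_funD.
apply: (@le_trans _ _ (\int[P]_x (G x `^ p)%:E)).
  apply: ae_ge0_le_integral => //.
  - by move=> x _; rewrite lee_fin powR_ge0.
  - exact: mp.
  - by move=> x _; rewrite lee_fin powR_ge0.
  - by apply: mp; exact: measurable_funD.
  - move: HG; apply: filterS => x HGx _.
    by rewrite lee_fin ge0_ler_powR ?nnegrE// ltW.
apply: integral_le_Lnorm => //; first by rewrite !addr_ge0.
rewrite (le_trans (minkowski_EFin _ mG12 _ p1))// EFinD; apply: leeD.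
  rewrite (le_trans (minkowski_EFin _ mG1 mG2 p1))// EFinD.
  by apply: leeD; exact: Lnorm_le_integral.
apply: Lnorm_le_integral => //.
by rewrite -[leRHS]mule1 -(probability_setT P) -integral_cst.
Qed.

End Lp_estimates.

(** Label [x] by the least [k] such that [r x] is within e / 2 of [a k]; images of points with the
    same label lie in one ball of that radius. *)
Lemma separable_partition (R : realType) (X : pmetricType R)
    (r : borel X -> borel X) (e : R) :
  measurable_fun setT r -> separable_range (r : X -> X) -> 0 < e ->
  exists q : borel X -> nat, (forall i, measurable (q @^-1` [set i])) /\
    forall x x', q x = q x' -> mdist (r x : X) (r x') < e.
Proof.
move=> mr [a ra] e0; have e20 : 0 < e / 2 by rewrite divr_gt0.
have /choice[q qP] : forall x : borel X, exists k,
    mdist (r x : X) (a k) < e / 2 /\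
    forall j, mdist (r x : X) (a j) < e / 2 -> (k <= j)%N.
  by move=> x; case: (ex_minnP (ra x _ e20)) => k ? ?; exists k.
exists q; split => [i|x x' xx'].
  pose N j : set (borel X) := [set x | mdist (r x : X) (a j) < e / 2].
  have mN j : measurable (N j) by exact: measurable_mdist_lt.
  rewrite (_ : _ @^-1` _ = N i `\` \bigcup_(j in `I_i) N j).
    by apply: measurableD => //; apply: (@fin_bigcup_measurable _ (borel X)).
  apply/seteqP; split => [x /= <-|x [/= Nix nN]].
    have [qx qmin] := qP x; split => //= -[j /= jq /qmin].
    by rewrite leqNgt jq.
  have [qx qmin] := qP x; apply/eqP; rewrite eqn_leq qmin//= leqNgt.
  by apply/negP => qi; apply: nN; exists (q x).
rewrite (le_lt_trans (metric_triangle _ (a (q x)) _))// [ltRHS]splitr ltrD//.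
  by have [] := qP x.
by rewrite metric_sym xx'; have [] := qP x'.
Qed.

(** * Approximate gluing *)

Section approximate_gluing.
Context (R : realType) (X : pmetricType R).
Local Notation bX := (borel X).
Local Notation bZ := (borel (sumprod X X)).
Local Notation bX4 := ((bX * bX) * (bX * bX))%type.
Local Open Scope ereal_scope.

(* In the order of the factors: ((x1, y1), (u1, x2), (v1, y2)), where [u1] is
   in the cell of [x1] and [v1] in the cell of [y1]. *)
Lemma glue_couplings (mu1 mu2 nu1 nu2 : probability bX R)
    (s h k : probability bZ R) (q : bX -> nat) :
  (forall i, measurable (q @^-1` [set i])) ->
  couplings mu1 nu1 s -> couplings mu1 mu2 h -> couplings nu1 nu2 k ->
  exists Q : probability (bZ * bZ * bZ)%type R,
    [/\ forall A, measurable A -> Q [set w | A w.1.1] = s A,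
        forall A, measurable A -> Q [set w | A w.1.2] = h A,
        forall A, measurable A -> Q [set w | A w.2] = k A &
        {ae Q, forall w, q w.1.1.1 = q w.1.2.1 /\ q w.1.1.2 = q w.2.1}].
Proof.
move=> mq [s1 s2] [h1 _] [k1 _].
have mq1 i : measurable ((q \o fst : bZ -> nat) @^-1` [set i]).
  exact: measurable_preimage (@measurable_fst_sumprod R X X) (mq i).
have mq2 i : measurable ((q \o snd : bZ -> nat) @^-1` [set i]).
  exact: measurable_preimage (@measurable_snd_sumprod R X X) (mq i).
(* Each gluing runs along the cells of a shared marginal: [mu1] for [s] and [h], then [nu1] for the
   glued law and [k]. *)
have sh i : s ((q \o fst : bZ -> nat) @^-1` [set i]) =
    h ((q \o fst : bZ -> nat) @^-1` [set i]).
  by transitivity (mu1 (q @^-1` [set i])); [exact: s1|apply/esym; exact: h1].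
have [Q1 [Q1s Q1h Q10]] := glue mq1 mq1 sh.
have mq2' i : measurable ((fun w : bZ * bZ => q w.1.2) @^-1` [set i]).
  exact: measurable_preimage (@measurable_fst _ _ bZ bZ) (mq2 i).
have Qk i : Q1 ((fun w : bZ * bZ => q w.1.2) @^-1` [set i]) =
    k ((q \o fst : bZ -> nat) @^-1` [set i]).
  transitivity (s ((q \o snd : bZ -> nat) @^-1` [set i])); first exact: Q1s.
  by transitivity (nu1 (q @^-1` [set i])); [exact: s2|apply/esym; exact: k1].
have [Q [QQ1 Qk' Q0]] := glue mq2' mq1 Qk.
exists Q; split.
- move=> A mA; rewrite -Q1s// -[RHS]QQ1//.
  exact: measurable_preimage (@measurable_fst _ _ bZ bZ) mA.
- move=> A mA; rewrite -Q1h// -[RHS]QQ1//.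
  exact: measurable_preimage (@measurable_snd _ _ bZ bZ) mA.
- exact: Qk'.
- have mN1 := measurable_neq_nat mq1 mq1.
  have mN2 := measurable_neq_nat mq2' mq1.
  have mN1' := measurable_preimage (@measurable_fst _ _ (bZ * bZ)%type bZ) mN1.
  exists ((fst @^-1` [set z : bZ * bZ | q z.1.1 != q z.2.1]) `|`
    [set w : bZ * bZ * bZ | q w.1.1.2 != q w.2.1]); split.
  + exact: measurableU.
  + apply/eqP; rewrite -measure_le0 (le_trans (measureU2 _ _ _))//.
    rewrite [X in X + _ <= _]QQ1// [X in X + _ <= _]Q10.
    by rewrite [X in _ + X <= _]Q0 adde0.
  + move=> w /= /not_andP[] /eqP; by [left|right].
Qed.

Variables (r : bX -> bX) (S : set bX).
Hypothesis mr : measurable_fun setT r.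
Hypothesis mS : measurable S.
Hypothesis sr : separable_range (r : X -> X).
Hypothesis rS : forall x, S x -> r x = x.

Definition retract2 d (T : measurableType d) (f g : T -> bX) (t : T) : bZ :=
  (r (f t), r (g t)).

Lemma measurable_retract2 d (T : measurableType d) (f g : T -> bX) :
  measurable_fun setT f -> measurable_fun setT g ->
  measurable_fun setT (retract2 f g).
Proof.
move=> mf mg; apply: measurable_sumprod.
- exact: measurableT_comp mr mf.
- exact: measurableT_comp mr mg.
- exact: separable_range_comp sr.
- exact: separable_range_comp sr.
Qed.

Definition retract4 (z : bX4) : borel (sumprod (sumprod X X) (sumprod X X)) :=
  ((r z.1.1, r z.1.2), (r z.2.1, r z.2.2)).

Lemma measurable_retract4 : measurable_fun setT retract4.
Proof.
apply: (@measurable_sumprod _ _ _ (sumprod X X) (sumprod X X)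
  (fun z : bX4 => (r z.1.1, r z.1.2)) (fun z : bX4 => (r z.2.1, r z.2.2))).
- by apply: measurable_retract2; exact: measurableT_comp.
- by apply: measurable_retract2; exact: measurableT_comp.
- by apply: separable_range_pair; exact: (separable_range_comp _ sr).
- by apply: separable_range_pair; exact: (separable_range_comp _ sr).
Qed.

(** This is the p-th power of the distance, in [sumprod X X], between the two halves of
    [retract4 z]. *)
Definition retract_cost p (z : bX4) : R :=
  ((mdist (r z.1.1 : X) (r z.2.1) + mdist (r z.1.2 : X) (r z.2.2)) `^ p)%R.

Lemma measurable_retract_cost p : measurable_fun setT (retract_cost p).
Proof.
apply/measurable_EFinP.
exact: measurableT_comp (@measurable_mdist_powR R (sumprod X X) p)
  measurable_retract4.
Qed.

Lemma measurable_square : measurable [set z : bZ | S z.1 /\ S z.2].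
Proof.
rewrite (_ : mkset _ = (fst @^-1` S) `&` (snd @^-1` S)).
  apply: measurableI.
    exact: measurable_preimage (@measurable_fst_sumprod R X X) mS.
  exact: measurable_preimage (@measurable_snd_sumprod R X X) mS.
by apply/seteqP; split.
Qed.

Lemma coupling_null (m m' : probability bX R) s : couplings m m' s ->
  m (~` S) = 0 -> m' (~` S) = 0 -> s (~` [set z | S z.1 /\ S z.2]) = 0.
Proof.
move=> [s1 s2] mS0 mS'0; have mCS : measurable (~` S) by exact: measurableC.
have m1 : measurable (fst @^-1` (~` S) : set bZ).
  exact: measurable_preimage (@measurable_fst_sumprod R X X) mCS.
have m2 : measurable (snd @^-1` (~` S) : set bZ).
  exact: measurable_preimage (@measurable_snd_sumprod R X X) mCS.
have -> : ~` [set z : bZ | S z.1 /\ S z.2] =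
    (fst @^-1` (~` S)) `|` (snd @^-1` (~` S)).
  by apply/seteqP; split => z /=; rewrite not_andP.
apply/eqP; rewrite -measure_le0 (le_trans (measureU2 s m1 m2))//.
rewrite -[leRHS]adde0; apply: leeD.
  by rewrite -mS0 -(s1 _ mCS); exact: lexx.
by rewrite -mS'0 -(s2 _ mCS); exact: lexx.
Qed.

Lemma retract2_coupling_cost p (m m' : probability bX R) s : couplings m m' s ->
  m (~` S) = 0 -> m' (~` S) = 0 ->
  \int[s]_z (mdist (r z.1 : X) (r z.2) `^ p)%:E <=
    \int[s]_z (mdist (z.1 : X) z.2 `^ p)%:E.
Proof.
move=> ms mS0 mS'0; apply: ae_ge0_le_integral => //.
- by move=> z _; rewrite lee_fin powR_ge0.
- exact: measurableT_comp (@measurable_mdist_powR R X p)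
    (measurable_retract2 (@measurable_fst_sumprod R X X)
      (@measurable_snd_sumprod R X X)).
- by move=> z _; rewrite lee_fin powR_ge0.
- exact: measurable_mdist_powR.
- exists (~` [set z | S z.1 /\ S z.2]); split.
  + by apply: measurableC; exact: measurable_square.
  + exact: coupling_null ms mS0 mS'0.
  + by move=> z /= nz [S1 S2]; apply: nz => _; rewrite !rS.
Qed.

Lemma approximate_gluing (mu1 mu2 nu1 nu2 : probability bX R)
    (s h k : probability bZ R) (p A B e : R) : (1 <= p)%R ->
  mu1 (~` S) = 0 -> mu2 (~` S) = 0 -> nu1 (~` S) = 0 -> nu2 (~` S) = 0 ->
  couplings mu1 nu1 s -> couplings mu1 mu2 h -> couplings nu1 nu2 k ->
  (0 <= A)%R -> (0 <= B)%R -> (0 < e)%R ->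
  \int[h]_z (mdist (z.1 : X) z.2 `^ p)%:E <= (A `^ p)%:E ->
  \int[k]_z (mdist (z.1 : X) z.2 `^ p)%:E <= (B `^ p)%:E ->
  exists L : probability bX4 R, [/\ box_marginals mu1 nu1 mu2 nu2 L,
    forall A B : set bX, measurable A -> measurable B ->
      L ((A `*` B) `*` (setT `*` setT)) = s (A `*` B) &
    \int[L]_z (retract_cost p z)%:E <= ((A + B + e) `^ p)%:E].
Proof.
move=> p1 S1 S2 S1' S2' cs ch ck A0 B0 e0 hA kB.
(* One cell diameter is lost for x and one for y, together at most [e]. *)
have e20 : (0 < e / 2)%R by rewrite divr_gt0.
have [q [mq qr]] := separable_partition mr sr e20.
have [Q [Qs Qh Qk Qq]] := glue_couplings mq cs ch ck.
have m11 : measurable_fun setT (fun w : bZ * bZ * bZ => w.1.1).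
  exact: measurableT_comp.
have m12 : measurable_fun setT (fun w : bZ * bZ * bZ => w.1.2).
  exact: measurableT_comp.
have m2 : measurable_fun setT (fun w : bZ * bZ * bZ => w.2).
  exact: measurable_snd.
have mfst : measurable_fun setT (fst : bZ -> bX).
  exact: measurable_fst_sumprod.
have msnd : measurable_fun setT (snd : bZ -> bX).
  exact: measurable_snd_sumprod.
(* The auxiliary points u1 and v1 are forgotten in the law [L]; the cost is still estimated through
   them, under [Q]. *)
pose F (w : bZ * bZ * bZ) : bX4 := ((w.1.1.1, w.1.1.2), (w.1.2.2, w.2.2)).
have mF : measurable_fun setT F.
  apply/measurable_fun_pairP; split; apply/measurable_fun_pairP; split.
  - exact: measurableT_comp mfst m11.
  - exact: measurableT_comp msnd m11.
  - exact: measurableT_comp msnd m12.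
  - exact: measurableT_comp msnd m2.
have [L LE] := law_ex Q mF.
have LA C : L C = Q (F @^-1` C) by rewrite LE.
exists L; split.
- split=> C mC; rewrite LA.
  + transitivity (s (fst @^-1` C)); last exact: cs.1.
    by apply: (Qs (fst @^-1` C)); exact: measurable_preimage.
  + transitivity (s (snd @^-1` C)); last exact: cs.2.
    by apply: (Qs (snd @^-1` C)); exact: measurable_preimage.
  + transitivity (h (snd @^-1` C)); last exact: ch.2.
    by apply: (Qh (snd @^-1` C)); exact: measurable_preimage.
  + transitivity (k (snd @^-1` C)); last exact: ck.2.
    by apply: (Qk (snd @^-1` C)); exact: measurable_preimage.
- move=> C D mC mD; rewrite LA.
  rewrite -Qs; last first.
    rewrite (_ : _ `*` _ = (fst @^-1` C) `&` (snd @^-1` D)).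
      by apply: measurableI; exact: measurable_preimage.
    by apply/seteqP; split => [[? ?] []|[? ?] []].
  by congr (Q _); apply/seteqP; split => w /= => [[]|].
- rewrite (integral_law mF (fun C _ => LA C)); first last.
  + by move=> z; rewrite lee_fin powR_ge0.
  + by apply/measurable_EFinP; exact: measurable_retract_cost.
  have mG (f : bZ * bZ * bZ -> bZ) : measurable_fun setT f ->
      measurable_fun setT (fun w => mdist (r (f w).1 : X) (r (f w).2) : R).
    move=> mf; apply: measurableT_comp (@measurable_mdist R X)
      (@measurable_retract2 _ _ (fst \o f) (snd \o f) _ _).
    - exact: measurableT_comp mfst mf.
    - exact: measurableT_comp msnd mf.
  have costE (g : bZ * bZ * bZ -> bZ) (t : probability bZ R) C m m' :
      measurable_fun setT g ->
      (forall A, measurable A -> Q (g @^-1` A) = t A) ->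
      couplings m m' t -> m (~` S) = 0 -> m' (~` S) = 0 ->
      \int[t]_z (mdist (z.1 : X) z.2 `^ p)%:E <= C ->
      \int[Q]_w (mdist (r (g w).1 : X) (r (g w).2) `^ p)%:E <= C.
    move=> mg Qt mt mS0 mS'0; apply: le_trans.
    rewrite -(integral_law (Q := t)
      (g := fun z : bZ => (mdist (r z.1 : X) (r z.2) `^ p)%:E) mg).
    - exact: retract2_coupling_cost mt mS0 mS'0.
    - by move=> D mD; rewrite Qt.
    - exact: measurableT_comp (@measurable_mdist_powR R X p)
        (measurable_retract2 mfst msnd).
    - by move=> z; rewrite lee_fin powR_ge0.
  apply: (@Lp_triangle _ _ R Q p p1
    (fun w => mdist (r w.1.1.1 : X) (r w.1.2.2) +
      mdist (r w.1.1.2 : X) (r w.2.2))%R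
    (fun w => mdist (r w.1.2.1 : X) (r w.1.2.2))
    (fun w => mdist (r w.2.1 : X) (r w.2.2))) => //.
  + exact: measurableT_comp (@measurable_mdist R (sumprod X X))
      (measurableT_comp measurable_retract4 mF).
  + exact: mG m12.
  + exact: mG m2.
  + by move=> w; apply: addr_ge0; exact: mdist_ge0.
  + by move=> w; exact: mdist_ge0.
  + by move=> w; exact: mdist_ge0.
  + exact: ltW.
  + have [N [mN QN QqN]] := Qq; exists N; split => // w nw.
    apply: QqN => -[q1 q2]; apply: nw => /=.
    have := qr _ _ q1; have := qr _ _ q2.
    have := metric_triangle (r w.1.1.1 : X) (r w.1.2.1) (r w.1.2.2).
    have := metric_triangle (r w.1.1.2 : X) (r w.2.1) (r w.2.2).
    move: (mdist (r w.1.1.1 : X) (r w.1.2.2)) (mdist (r w.1.1.2 : X) (r w.2.2)).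
    move: (mdist (r w.1.2.1 : X) (r w.1.2.2)) (mdist (r w.2.1 : X) (r w.2.2)).
    move: (mdist (r w.1.1.1 : X) (r w.1.2.1)) (mdist (r w.1.1.2 : X) (r w.2.1)).
    by move=> ? ? ? ? ? ?; lra.
  + exact: costE m12 Qh ch S1 S2 hA.
  + exact: costE m2 Qk ck S1' S2' kB.
Qed.

End approximate_gluing.

(** * Exact gluing in the limit *)

Section exact_gluing.
Context (R : realType) (X : pmetricType R).
Local Notation bX := (borel X).
Local Notation bZ := (borel (sumprod X X)).
Local Notation bX4 := ((bX * bX) * (bX * bX))%type.
Local Open Scope ereal_scope.
Variables (r : bX -> bX) (S : set bX).
Hypothesis mr : measurable_fun setT r.
Hypothesis mS : measurable S.
Hypothesis sr : separable_range (r : X -> X).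
Hypothesis rS : forall x, S x -> r x = x.

Lemma retract_cost_lsc (p : R) (z : bX4) (e : R) : (0 < p)%R -> (0 < e)%R ->
  exists2 d, (0 < d)%R & forall z' : bX4,
  (mdist (r z.1.1 : X) (r z'.1.1) < d)%R ->
  (mdist (r z.1.2 : X) (r z'.1.2) < d)%R ->
  (mdist (r z.2.1 : X) (r z'.2.1) < d)%R ->
  (mdist (r z.2.2 : X) (r z'.2.2) < d)%R ->
  (retract_cost r p z - e <= retract_cost r p z')%R.
Proof.
move=> p0 e0.
have D0 (w : bX4) :
    (0 <= mdist (r w.1.1 : X) (r w.2.1) + mdist (r w.1.2 : X) (r w.2.2))%R.
  by apply: addr_ge0; exact: mdist_ge0.
have [d d0 zd] := powR_lower_continuous p0 (D0 z) e0.
(* The sum of two distances involves four points, each of which moves by less than d / 4. *)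
exists (d / 4)%R; first by rewrite divr_gt0.
move=> z' h1 h2 h3 h4; apply: zd; first exact: D0.
have := metric_triangle (r z.1.1 : X) (r z'.1.1) (r z.2.1).
have := metric_triangle (r z'.1.1 : X) (r z'.2.1) (r z.2.1).
have := metric_triangle (r z.1.2 : X) (r z'.1.2) (r z.2.2).
have := metric_triangle (r z'.1.2 : X) (r z'.2.2) (r z.2.2).
rewrite (metric_sym (r z'.2.1 : X)) (metric_sym (r z'.2.2 : X)).
move: h1 h2 h3 h4; clear -d.
move: (mdist (r z.1.1 : X) (r z'.1.1)) (mdist (r z.1.2 : X) (r z'.1.2)).
move: (mdist (r z.2.1 : X) (r z'.2.1)) (mdist (r z.2.2 : X) (r z'.2.2)).
move: (mdist (r z.1.1 : X) (r z.2.1)) (mdist (r z.1.2 : X) (r z.2.2)).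
move: (mdist (r z'.1.1 : X) (r z'.2.1)) (mdist (r z'.1.2 : X) (r z'.2.2)).
move: (mdist (r z'.1.1 : X) (r z.2.1)) (mdist (r z'.1.2 : X) (r z.2.2)).
move=> ? ? ? ? ? ? ? ? ? ?; lra.
Qed.

(* Borel sets of [sumprod X X] need not belong to the product sigma-algebra, but
   their preimages under [r] x [r] do. *)
Lemma retract_joint_law (s : probability bZ R) (M : probability bX4 R) :
  s (~` [set z | S z.1 /\ S z.2]) = 0 ->
  (forall A B : set bX, measurable A -> measurable B ->
    M ((A `*` B) `*` (setT `*` setT)) = s (A `*` B)) ->
  forall E : set bZ, measurable E -> M [set z | E (r z.1.1, r z.1.2)] = s E.
Proof.
move=> s0 Ms E mE.
have mfst : measurable_fun setT (fst : bZ -> bX).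
  exact: measurable_fst_sumprod.
have msnd : measurable_fun setT (snd : bZ -> bX).
  exact: measurable_snd_sumprod.
(* The identity is measurable from the Borel sets to the product sigma-algebra, so [s] can be
   compared with [M] on the latter, where rectangles determine a probability. *)
have mid : measurable_fun setT (fun z : bZ => (z.1, z.2) : bX * bX).
  exact: measurable_fun_pair.
have [s' s'E] := law_ex s mid.
have [M' M'E] := law_ex M (@measurable_fst _ _ (bX * bX)%type (bX * bX)%type).
have s'A C : s' C = s ((fun z : bZ => (z.1, z.2) : bX * bX) @^-1` C).
  by rewrite s'E.
have M'A C : M' C = M (fst @^-1` C) by rewrite M'E.
have sM C : measurable C -> s' C = M' C.
  move=> mC.
  apply: (measure_unique
    [set A `*` B | A in @measurable _ bX & B in @measurable _ bX]
    (fun=> setT)) => //.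
  - exact: measurable_prod_measurableType.
  - move=> _ _ [A1 mA1 [B1 mB1 <-]] [A2 mA2 [B2 mB2 <-]].
    exists (A1 `&` A2); first exact: measurableI.
    by exists (B1 `&` B2); [exact: measurableI|rewrite setXI].
  - by move=> _; exists setT => //; exists setT => //; rewrite setXTT.
  - by rewrite bigcup_const//; exists 0%N.
  - move=> _ [A mA [B mB <-]].
    transitivity (s (A `*` B)).
      by rewrite [LHS]s'A; congr (s _).
    rewrite -Ms// [RHS]M'A; congr (M _).
    by apply/seteqP; split => [[[x y] c] [[/= ? ?] _]|[[x y] c] [/= ? ?]].
  - by move=> _; rewrite [ltLHS]probability_setT ltry.
have mrr : measurable_fun setT (retract2 r (@fst bX bX) (@snd bX bX)).
  by apply: measurable_retract2.
pose rho (z : bZ) : bZ := (r z.1, r z.2).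
have mrho : measurable_fun setT rho by exact: measurable_retract2.
have mrE : measurable (retract2 r (@fst bX bX) (@snd bX bX) @^-1` E).
  exact: measurable_preimage mrr mE.
rewrite -(measure_preimage_id (measurable_square mS) s0 mrho _ mE); last first.
  by move=> [x y] [/= Sx Sy]; rewrite /rho/= !rS.
transitivity (M' (retract2 r (@fst bX bX) (@snd bX bX) @^-1` E)).
  by rewrite M'A.
by rewrite -sM// s'A.
Qed.

Variables mu1 mu2 nu1 nu2 : probability bX R.
Hypothesis (mu1S : mu1 (~` S) = 0) (mu2S : mu2 (~` S) = 0).
Hypothesis (nu1S : nu1 (~` S) = 0) (nu2S : nu2 (~` S) = 0).

(** Applying [r] to the last two coordinates turns a law on the product sigma-algebra into a Borel
    one, and leaves the marginals unchanged because they are carried by [S]. *)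
Lemma coupling_of_box_measure (M : probability bX4 R) :
  (forall A : set bX, measurable A -> M [set z | A z.2.1] = mu2 A) ->
  (forall A : set bX, measurable A -> M [set z | A z.2.2] = nu2 A) ->
  exists s2 : probability bZ R, couplings mu2 nu2 s2 /\
    forall E, measurable E -> s2 E = M [set z | E (r z.2.1, r z.2.2)].
Proof.
move=> M3 M4.
have m21 : measurable_fun setT (fun z : bX4 => z.2.1).
  exact: measurableT_comp.
have m22 : measurable_fun setT (fun z : bX4 => z.2.2).
  exact: measurableT_comp.
have [s2 s2E] := law_ex M (measurable_retract2 mr sr m21 m22).
have mrA A : measurable A -> measurable (r @^-1` A).
  exact: measurable_preimage.
exists s2; split; last by move=> E mE; rewrite s2E.
split=> A mA; rewrite /pushforward s2E.
  transitivity (mu2 (r @^-1` A)); last first.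
    exact: measure_preimage_id mS mu2S mr rS mA.
  exact: (M3 _ (mrA _ mA)).
transitivity (nu2 (r @^-1` A)); last first.
  exact: measure_preimage_id mS nu2S mr rS mA.
exact: (M4 _ (mrA _ mA)).
Qed.

Lemma exact_gluing (p w1 w2 : R) (s1 : probability bZ R) : (1 <= p)%R ->
  radon mu1 -> radon mu2 -> radon nu1 -> radon nu2 -> couplings mu1 nu1 s1 ->
  kantorovich p mu1 mu2 = w1%:E -> kantorovich p nu1 nu2 = w2%:E ->
  exists s2 : probability bZ R,
    couplings mu2 nu2 s2 /\ kantorovich p s1 s2 <= (w1 + w2)%:E.
Proof.
move=> p1 r1 r2 r1' r2' cs W1 W2.
have p0 : (0 < p)%R by exact: lt_le_trans p1.
have w10 : (0 <= w1)%R by rewrite -lee_fin -W1 kantorovich_ge0.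
have w20 : (0 <= w2)%R by rewrite -lee_fin -W2 kantorovich_ge0.
have mT : @measurable _ bX setT := measurableT.
have /choice[L LP] : forall n : nat, exists L : probability bX4 R,
  [/\ box_marginals mu1 nu1 mu2 nu2 L,
    forall A B : set bX, measurable A -> measurable B ->
      L ((A `*` B) `*` (setT `*` setT)) = s1 (A `*` B) &
    \int[L]_z (retract_cost r p z)%:E <=
      ((w1 + n.+1%:R^-1 + (w2 + n.+1%:R^-1) + n.+1%:R^-1) `^ p)%:E].
  move=> n; have n0 : (0 < n.+1%:R^-1 :> R)%R by rewrite invr_gt0 ltr0n.
  have [h ch hA] := kantorovich_near_optimal p0 W1 n0.
  have [k ck kB] := kantorovich_near_optimal p0 W2 n0.
  apply: (approximate_gluing mr mS sr rS p1 mu1S mu2S nu1S nu2S cs ch ck) => //.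
  - by rewrite addr_ge0// ltW.
  - by rewrite addr_ge0// ltW.
(* [U] refines \oo, so estimates valid for all large [n] hold along [U]. *)
have [U [UU ooU]] := @ultraFilterLemma nat \oo _.
have LM n : box_marginals mu1 nu1 mu2 nu2 (L n) by have [] := LP n.
have [M ML] := box_limit UU r1 r1' r2 r2' LM.
(* Box masses independent of [n] keep their value in the limit: this fixes the joint law of (x1, y1)
   and the marginals of x2 and y2. *)
have box_cst (A1 A2 A3 A4 : set bX) (c : \bar R) :
    measurable A1 -> measurable A2 -> measurable A3 -> measurable A4 ->
    (forall n, L n ((A1 `*` A2) `*` (A3 `*` A4)) = c) ->
    M ((A1 `*` A2) `*` (A3 `*` A4)) = c.
  move=> mA1 mA2 mA3 mA4 Lc.
  have mA : measurable ((A1 `*` A2) `*` (A3 `*` A4) : set bX4).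
    by apply: measurableX; exact: measurableX.
  have := ML _ _ _ _ mA1 mA2 mA3 mA4.
  rewrite (_ : (fun n => _) = cst (fine c)); last first.
    by apply/funext => n; rewrite Lc.
  move=> /(cvg_lim (@Rhausdorff R)); rewrite lim_cst; last exact: Rhausdorff.
  move=> cM; rewrite -[LHS]fineK ?fin_num_measure// -cM fineK//.
  by rewrite -(Lc 0%N) fin_num_measure.
have [s2 [cs2 s2M]] : exists s2 : probability bZ R, couplings mu2 nu2 s2 /\
    forall E, measurable E -> s2 E = M [set z | E (r z.2.1, r z.2.2)].
  apply: coupling_of_box_measure => A mA.
    rewrite (_ : mkset _ = (setT `*` setT) `*` (A `*` setT)); last first.
      by apply/seteqP; split => [[? [? ?]] ?|[? [? ?]] [_ []]].
    apply: box_cst => // n; have [_ _ <- // _] := LM n.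
    by congr (L n _); apply/seteqP; split => [[? [? ?]] [_ []]|[? [? ?]] ?].
  rewrite (_ : mkset _ = (setT `*` setT) `*` (setT `*` A)); last first.
    by apply/seteqP; split => [[? [? ?]] ?|[? [? ?]] [_ []]].
  apply: box_cst => // n; have [_ _ _ <- //] := LM n.
  by congr (L n _); apply/seteqP; split => [[? [? ?]] [_ []]|[? [? ?]] ?].
exists s2; split => //.
have mr4 := measurable_retract4 mr sr.
(* The plan between [s1] and [s2]: the first half of [retract4] has law [s1] under [M], the second
   half has law [s2]. *)
have [t tM] := law_ex M mr4.
have s1M (E : set bZ) : measurable E ->
    M [set z | E (r z.1.1, r z.1.2)] = s1 E.
  move: E; apply: retract_joint_law; first exact: coupling_null cs mu1S nu1S.
  move=> A B mA mB; apply: box_cst => // n.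
  by have [_ LAB _] := LP n; exact: LAB.
have ct : couplings s1 s2 t.
  split=> E mE; rewrite /pushforward tM; first exact: s1M.
  by rewrite s2M.
apply: (le_trans (kantorovich_le p0 ct)).
have -> : (w1 + w2)%:E = ((w1 + w2) `^ p)%:E `^ p^-1.
  by rewrite poweR_EFin -powRrM mulfV ?gt_eqF// powRr1// addr_ge0.
apply: gt0_ler_poweR; first by rewrite invr_ge0 ltW.
- rewrite in_itv/= leey andbT; apply: integral_ge0 => z _.
  by rewrite lee_fin powR_ge0.
- by rewrite in_itv/= leey andbT lee_fin powR_ge0.
have tE A : measurable A -> t A = M (retract4 r @^-1` A) by rewrite tM.
rewrite (integral_law mr4 tE (@measurable_mdist_powR R (sumprod X X) p));
  last first.
  by move=> z; rewrite lee_fin powR_ge0.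
have [a ra] := sr.
apply: (@integral_box_limit_le R X r a mr ra (retract_cost r p) _ _ U L M).
- by move=> z; exact: powR_ge0.
- by move=> z e e0; exact: retract_cost_lsc.
- exact: ML.
- exact: measurable_retract_cost.
move=> e e0.
have [d d0 hd] := powR_upper_continuous p0 (addr_ge0 w10 w20) e0.
(* Three errors 1/(n+1) must fit into [d]: one for each near-optimal plan and one for the mesh. *)
apply: ooU; have d30 : (0 < d / 3)%R by rewrite divr_gt0.
apply: filterS (near_infty_natSinv_lt (PosNum d30)) => n /= nd.
have [_ _ Ln] := LP n; apply: (le_trans Ln); rewrite lee_fin.
apply: le_trans hd; apply: ge0_ler_powR; first exact: ltW.
- by rewrite nnegrE !addr_ge0.
- by rewrite nnegrE !addr_ge0// ltW.
- by move: nd; move: (n.+1%:R^-1)%R => u; lra.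
Qed.

(** The product measure is defined on the product sigma-algebra; its image under [r] x [r] is a
    Borel coupling. *)
Lemma couplings_nonempty : exists s2 : probability bZ R, couplings mu2 nu2 s2.
Proof.
have prodE A B : measurable A -> measurable B ->
    (mu2 \x nu2) (A `*` B) = mu2 A * nu2 B.
  exact: product_measure1E.
have mn1 : (mu2 \x nu2) setT = 1.
  transitivity ((mu2 \x nu2) ([set: bX] `*` [set: bX])).
    by rewrite setXTT.
  rewrite [LHS]prodE//.
  by rewrite [X in X * _]probability_setT [X in _ * X]probability_setT mule1.
have [P PE] := probability_ex mn1.
have PX A B : measurable A -> measurable B -> P (A `*` B) = mu2 A * nu2 B.
  by move=> mA mB; rewrite PE; exact: prodE.
have [s2 s2E] := law_ex P (measurable_retract2 mr sr
  (@measurable_fst _ _ bX bX) (@measurable_snd _ _ bX bX)).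
have mrA A : measurable A -> measurable (r @^-1` A).
  exact: measurable_preimage.
exists s2; split=> A mA; rewrite /pushforward s2E.
  transitivity (mu2 (r @^-1` A)); last first.
    exact: measure_preimage_id mS mu2S mr rS mA.
  transitivity (P ((r @^-1` A) `*` setT)).
    by congr (P _); apply/seteqP; split => [[x y]|[x y] []].
  by rewrite PX//; [rewrite [X in _ * X]probability_setT mule1|exact: mrA].
transitivity (nu2 (r @^-1` A)); last first.
  exact: measure_preimage_id mS nu2S mr rS mA.
transitivity (P (setT `*` (r @^-1` A))).
  by congr (P _); apply/seteqP; split => [[x y]|[x y] []].
by rewrite PX//; [rewrite [X in X * _]probability_setT mul1e|exact: mrA].
Qed.

End exact_gluing.

(** * Lifting couplings and the Hausdorff bound *)

(** One set [S] serves all four measures. If one of the two distances is infinite, the right-hand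
    side is infinite and any coupling will do; otherwise the gluing applies. *)
Lemma kantorovich_lift (R : realType) (X : pmetricType R) (p : R)
    (mu1 mu2 nu1 nu2 : probability (borel X) R) s1 :
  1 <= p -> radon mu1 -> radon mu2 -> radon nu1 -> radon nu2 ->
  couplings mu1 nu1 s1 ->
  exists s2 : probability (borel (sumprod X X)) R, couplings mu2 nu2 s2 /\
    (kantorovich p s1 s2 <= kantorovich p mu1 mu2 + kantorovich p nu1 nu2)%E.
Proof.
move=> p1 r1 r2 r1' r2' cs.
have [i|S [r [mS S0 mr sr rS]]] :=
    (* The four measures become a sequence by repeating [mu1], the default of [nth], from index 4
       on. *)
    @radon_separable_retraction R X (nth mu1 [:: mu1; mu2; nu1; nu2]).
  by case: i => [|[|[|[|i]]]] //=; rewrite nth_default.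
have mu1S := S0 0%N; have mu2S := S0 1%N.
have nu1S := S0 2%N; have nu2S := S0 3%N.
have [fW1|W1] := boolP (kantorovich p mu1 mu2 \is a fin_num); last first.
  have [s2 cs2] := couplings_nonempty mr mS sr rS mu2S nu2S.
  exists s2; split => //; rewrite ge0_fin_numE ?kantorovich_ge0// in W1.
  rewrite (_ : kantorovich p mu1 mu2 = +oo%E); last first.
    by apply/eqP; rewrite -leye_eq leNgt.
  by rewrite addye ?leey// gt_eqF// (lt_le_trans _ (kantorovich_ge0 _ _ _)).
have [fW2|W2] := boolP (kantorovich p nu1 nu2 \is a fin_num); last first.
  have [s2 cs2] := couplings_nonempty mr mS sr rS mu2S nu2S.
  exists s2; split => //; rewrite ge0_fin_numE ?kantorovich_ge0// in W2.
  rewrite (_ : kantorovich p nu1 nu2 = +oo%E); last first.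
    by apply/eqP; rewrite -leye_eq leNgt.
  by rewrite addey ?leey// gt_eqF// (lt_le_trans _ (kantorovich_ge0 _ _ _)).
rewrite -(fineK fW1) -(fineK fW2) -EFinD.
apply: (exact_gluing mr mS sr rS mu1S mu2S nu1S nu2S p1 r1 r2 r1' r2' cs).
  by rewrite fineK.
by rewrite fineK.
Qed.

Theorem corollary3p3 (R : realType) (X : pmetricType R) (p : R)
    (mu1 mu2 nu1 nu2 : probability (borel X) R) :
  1 <= p ->
  radon_p p mu1 -> radon_p p mu2 -> radon_p p nu1 -> radon_p p nu2 ->
  (forall sigma1 : probability (borel (sumprod X X)) R,
     couplings mu1 nu1 sigma1 ->
     exists sigma2 : probability (borel (sumprod X X)) R,
       couplings mu2 nu2 sigma2 /\
       (kantorovich p sigma1 sigma2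
          <= kantorovich p mu1 mu2 + kantorovich p nu1 nu2)%E) /\
  (kantorovich_hausdorff p (couplings mu1 nu1) (couplings mu2 nu2)
     <= kantorovich p mu1 mu2 + kantorovich p nu1 nu2)%E.
Proof.
move=> p1 [r1 _] [r2 _] [r1' _] [r2' _]; split.
  by move=> s1; exact: kantorovich_lift.
rewrite /kantorovich_hausdorff ge_max; apply/andP; split.
  apply: ge_ereal_sup => _ [s1 cs1 <-].
  have [s2 [cs2 W]] := kantorovich_lift p1 r1 r2 r1' r2' cs1.
  by apply: le_trans W; apply: ereal_inf_lbound; exists s2.
apply: ge_ereal_sup => _ [s2 cs2 <-].
(* The other supremum exchanges the two pairs; symmetry of the distance restores the same bound. *)
have [s1 [cs1 W]] := kantorovich_lift p1 r2 r1 r2' r1' cs2.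
rewrite (kantorovich_sym p mu1) (kantorovich_sym p nu1).
apply: le_trans W; apply: ereal_inf_lbound; exists s1 => //.
exact: kantorovich_sym.
Qed.
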